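(* Let $I$ be a monomial ideal of $R=K[x_1,\ldots,x_n]$ of height at least $2$ and let $\mathrm{sgn}(I)$ be its signature. The following hold. (a) $\mathrm{depth}(R/I)=\mathrm{depth}(R/\mathrm{sgn}(I))$. (b) $\dim(R/I)=\dim(R/\mathrm{sgn}(I))$. (c) $R/I$ is a Cohen--Macaulay ring (resp. Gorenstein ring) if and only if $R/\mathrm{sgn}(I)$ is a Cohen--Macaulay ring (resp. Gorenstein ring). (d) $\mathrm{reg}(R/I)\geq \mathrm{reg}(R/\mathrm{sgn}(I))$.
   Context: $K$ is a field and $R=K[x_1,\ldots,x_n]$ is a polynomial ring with the standard grading. For $a=(a_1,\ldots,a_n)\in\mathbb{N}^n$ (with $0\in\mathbb N$), $x^a:=x_1^{a_1}\cdots x_n^{a_n}$. A monomial ideal $I$ of $R$ has a unique finite minimal set of monomial generators $G(I)=\{x^{v_1},\ldots,x^{v_q}\}$. The incidence matrix of $I$ is the $n\times q$ matrix $A$ with columns $v_1,\ldots,v_q$. Signature: for each row $c=(c_1,\ldots,c_q)$ of $A$, list its distinct entries in ascending order $m_0<m_1<\cdots<m_r$, let $j_i$ be the index with $c_i=m_{j_i}$, and put $\mathrm{sgn}(c)=(j_1,\ldots,j_q)$. The matrix $\mathrm{sgn}(A)$ has rows $\mathrm{sgn}(c)$, with $c$ running over the rows of $A$. The signature $\mathrm{sgn}(I)$ is the ideal of $R$ generated by the monomials $x^w$ with $w$ a column of $\mathrm{sgn}(A)$. $\mathrm{reg}$ denotes Castelnuovo--Mumford regularity (as an $R$-module). $R/I$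 is Gorenstein if it is Cohen--Macaulay of type $1$. *)

(* Defs.v *)
From Stdlib Require Export ClassicalEpsilon.
From HB Require Import structures.
From mathcomp Require Export all_boot all_order all_algebra.
From mathcomp Require Export multinomials.mpoly.

Set Implicit Arguments.
Unset Strict Implicit.
Unset Printing Implicit Defensive.

Import Order.TTheory GRing.Theory Num.Theory.
Local Open Scope ring_scope.

(* The value of [maximum x0 P] is unspecified when P has no maximum. *)
Definition is_max d (T : porderType d) (P : T -> Prop) (x : T) : Prop :=
  P x /\ forall y, P y -> (y <= x)%O.

Definition maximum d (T : porderType d) (x0 : T) (P : T -> Prop) : T :=
  epsilon (inhabits x0) (is_max P).

Section Ideals.
Variable R : comNzRingType.
Implicit Types (I S : R -> Prop) (P Q : {pred R}).

Definition ideal_gen S (f : R) : Prop :=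
  exists2 c : seq (R * R), (forall p, p \in c -> S p.2)
    & f = \sum_(p <- c) p.1 * p.2.

(* [idealr_closed] includes properness. *)
Definition prime_ideal P : Prop := idealr_closed P /\ prime_idealr_closed P.

(* P 0 < P 1 < ... < P k; the values P i for i > k are irrelevant. *)
Definition prime_chain (k : nat) (P : nat -> {pred R}) : Prop :=
  (forall i, (i <= k)%N -> prime_ideal (P i)) /\
  (forall i, (i < k)%N ->
     {subset P i <= P i.+1} /\ ~ {subset P i.+1 <= P i}).

(* ht I >= k, where ht I is the infimum of the heights of the primes
   containing I, so that the unit ideal has infinite height. *)
Definition height_ge I (k : nat) : Prop :=
  forall Q, prime_ideal Q -> (forall f, I f -> f \in Q) ->
  exists2 P : nat -> {pred R}, prime_chain k P & P k =i Q.

(* Krull dimension of R/I, through the primes of R containing I. *)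
Definition quot_dim I : nat :=
  maximum 0%N (fun k => exists2 P : nat -> {pred R},
    prime_chain k P & forall f, I f -> f \in P 0%N).

Definition ideal_add I (s : seq R) : R -> Prop :=
  ideal_gen (fun f => I f \/ f \in s).

(* s is a sequence of elements of M that is regular on R/I. *)
Definition regular_seq (M I : R -> Prop) (s : seq R) : Prop :=
  [/\ forall f, f \in s -> M f,
      forall i, (i < size s)%N -> forall g,
        ideal_add I (take i s) (s`_i * g) -> ideal_add I (take i s) g
    & ~ ideal_add I s 1].

Definition max_regular_seq (M I : R -> Prop) (s : seq R) : Prop :=
  regular_seq M I s /\ forall f, ~ regular_seq M I (rcons s f).

End Ideals.

Section GradedRing.
Variables (K : fieldType) (n : nat).
Local Notation R := {mpoly K[n]}.
Implicit Types (I J : R -> Prop).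

Definition irrelevant : R -> Prop := ideal_gen (fun g => exists i, g = 'X_i).

Definition quot_depth I : nat :=
  maximum 0%N (fun k => exists2 s : seq R, regular_seq irrelevant I s
                                         & size s = k).

Definition cohen_macaulay I : Prop := quot_depth I = quot_dim I.

(* dim_K Soc(R/J) = t, where Soc(R/J) = (0 : (x_1, ..., x_n)): there are t
   elements of R whose classes form a K-basis of the socle. *)
Definition in_socle J (f : R) : Prop :=
  forall g, irrelevant g -> J (g * f).

Definition socle_dim J (t : nat) : Prop :=
  exists2 b : 'I_t -> R, (forall i, in_socle J (b i))
    & forall f, in_socle J f ->
        exists! c : 'rV[K]_t, J (f - \sum_i c 0 i *: b i).

(* The type of a Cohen-Macaulay R/I: the socle dimension of R/(I, s) for s a
   maximal regular sequence (it does not depend on s). *)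
Definition cm_type I (t : nat) : Prop :=
  exists2 s : seq R, max_regular_seq irrelevant I s
                   & socle_dim (ideal_add I s) t.

Definition gorenstein I : Prop := cohen_macaulay I /\ cm_type I 1.

(* Minimal graded free resolutions
     ... -> F_2 -> F_1 -> F_0 = R -> R/I -> 0,
   with F_i = R(-a_(i,1)) + ... + R(-a_(i,b_i)), represented by row vectors;
   the map F_(i+1) -> F_i is v |-> v *m diff i.  Shifts in nat suffice: F_0 is
   generated in degree 0 and by minimality degrees grow along the resolution. *)
Record min_graded_res I : Type := MinGradedRes {
  rk : nat -> nat;
  shift : forall i, 'I_(rk i) -> nat;
  diff : forall i, 'M[R]_(rk i.+1, rk i);
  rk0 : rk 0 = 1%N;
  shift0 : forall k, @shift 0 k = 0%N;
  diff_homog : forall i k l, diff i k l != 0 ->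
    exists2 e : nat, @shift i.+1 k = (@shift i l + e)%N
                   & diff i k l \is e.-homog;
  diff_min : forall i k l, irrelevant (diff i k l);
  augmentation_exact : forall v : 'rV[R]_(rk 0),
    (forall k, I (v 0 k)) <-> exists w, v = w *m diff 0;
  diff_exact : forall i (v : 'rV[R]_(rk i.+1)),
    v *m diff i = 0 <-> exists w, v = w *m diff i.+1 }.

Definition betti I (F : min_graded_res I) (i j : nat) : nat :=
  #|[set k : 'I_(rk F i) | shift k == j]|.

Definition regularity I : int :=
  maximum 0 (fun r : int => exists F : min_graded_res I, exists i j : nat,
    betti F i j != 0%N /\ r = j%:Z - i%:Z).

Definition monomial_ideal I : Prop :=
  exists S : 'X_{1..n} -> Prop, forall f,
    I f <-> ideal_gen (fun g => exists2 m, S m & g = 'X_[m]) f.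

Definition col_mnm (q : nat) (A : 'M[nat]_(n, q)) (j : 'I_q) : 'X_{1..n} :=
  [multinom A i j | i < n].

Definition col_ideal (q : nat) (A : 'M[nat]_(n, q)) (T : {set 'I_q}) :
    R -> Prop :=
  ideal_gen (fun g => exists2 j, j \in T & g = 'X_[col_mnm A j]).

(* The columns of A are, without repetition, the exponents of G(I). *)
Definition incidence_matrix I (q : nat) (A : 'M[nat]_(n, q)) : Prop :=
  (forall f, I f <-> col_ideal A setT f) /\
  (forall T, (forall f, I f <-> col_ideal A T f) -> T = setT).

Definition sgn_mx (q : nat) (A : 'M[nat]_(n, q)) : 'M[nat]_(n, q) :=
  \matrix_(i, j) index (A i j) (sort leq (undup [seq A i k | k : 'I_q])).

(* The incidence matrix of a monomial ideal exists and is unique up to a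
   permutation of its columns, which does not change the ideal below. *)
Definition sgn_ideal I (f : R) : Prop :=
  exists q (A : 'M[nat]_(n, q)),
    incidence_matrix I A /\ col_ideal (sgn_mx A) setT f.

End GradedRing.

(* Main.v *)
Require Import Defs.
From HB Require Import structures.
From mathcomp Require Import ring zify.
From Stdlib Require Import FunctionalExtensionality PropExtensionality.
Import Order.TTheory GRing.Theory Num.Theory.
Local Open Scope ring_scope.
Set Implicit Arguments.
Unset Strict Implicit.
Unset Printing Implicit Defensive.

(** Write m for the ideal generated by the variables and I' for sgn(I).  Since
    I has height at least 2, either I is the whole ring, and then so is I', or
    no variable divides all generators, so that every row of the incidence
    matrix contains the entry 0 ([height_var]).  The signature then replaces, in
    each row, the sorted values 0 = v_0 < ... < v_r by 0, ..., r.  An entry is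
    zero exactly when its label is, and a prime ideal contains a monomial
    exactly when it contains one of its variables, so I and I' lie in the same
    primes: this settles the dimension ([prime_col_ideal]).

    Depth, type and Betti numbers are all read off the Koszul homology of the
    variables with coefficients in R/I.  This homology is graded by N^n, and in
    multidegree a the complex only depends on which of the monomials x^(a - G),
    for sets G of variables in the support of a, belong to I ([slice_kos]).  If
    some nonzero a_j is not an entry of row j, then dividing by x_j does not
    change membership in I, and the piece of degree a is a cone, hence acyclic
    ([cone_bound]).  The remaining multidegrees are the vectors of entries, and
    the vector of entries a and its vector of labels b give the same complex for
    I and I' ([above_relabel]).  Thus relabelling the multidegrees identifies the
    two Koszul homologies ([transport], [transportK]), and degrees can only drop
    because an entry is at least its label.

    It remains to recover the invariants from Koszul homology.

    For depth, an element of m acts as 0 on Koszul homology, through an explicit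
    homotopy; so if f in m is regular modulo J, the long exact sequence of
    multiplication by f falls apart, and the homotopy itself identifies H_p of
    R/J with H_(p+1) of R/(J, f) once H_(p+1)(R/J) = 0 ([kline_regular]).
    Since H_n(R/J) is the socle of R/J, and since a trivial socle forces m to
    contain an element regular modulo J ([exists_regular], prime avoidance in a
    Noetherian ring), R/J has a regular sequence of length k in m exactly when
    H_p(R/J) = 0 for all p > n - k ([depth_geP]), and the type is the dimension
    of H_(n - depth) ([cm_type1P]).

    For regularity, a minimal graded free resolution F of R/I exists
    ([min_graded_res_ex]), and dimension shifting along F identifies the degree
    j part of H_i(R/I) with that of F_i/mF_i ([betti_eq0]): the Betti number at
    (i, j) vanishes exactly when that part of the homology does.  So a nonzero
    Betti number of I' at (i, j) yields one of I at some (i, j') with j' >= j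
    ([graded_vanish_le]), and the regularity of I is at least that of I'. *)

(** * Koszul chains *)

Lemma sum_antisym (V : zmodType) m (F : 'I_m -> 'I_m -> V) :
  (forall j, F j j = 0) -> (forall j l, F l j = - F j l) ->
  \sum_j \sum_l F j l = 0.
Proof.
move=> F0 FN.
have split (j : 'I_m) : \sum_l F j l =
    \sum_(l < m | (j < l)%N) F j l + \sum_(l < m | (l < j)%N) F j l.
  rewrite (bigID (fun l : 'I_m => (j < l)%N)) /=; congr (_ + _).
  rewrite (bigD1 j) ?ltnn //= F0 add0r; apply: eq_bigl => l.
  by rewrite -leqNgt ltn_neqAle andbC.
rewrite (eq_bigr _ (fun j _ => split j)) big_split /=.
rewrite [X in _ + X](exchange_big_dep xpredT) //= -big_split /=.
rewrite big1 // => j _; rewrite -big_split big1 // => l _ /=.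
by rewrite FN addNr.
Qed.

Section Koszul.
Variables (n : nat) (R : comNzRingType) (V : lmodType R) (x : 'I_n -> R).
Implicit Types (c : {set 'I_n} -> V) (G : {set 'I_n}) (j l : 'I_n).

(** The sign of the permutation that moves e_j to its place in e_j ^ e_G. *)
Definition ksign j G : R := \prod_(k in G) (-1) ^+ (k < j)%N.

(** The Koszul differential. A chain c is the element of the exterior algebra
    whose coefficient on e_G, the wedge of the e_k for k in G, is c G. *)
Definition kos c G : V := \sum_(j | j \notin G) (ksign j G * x j) *: c (j |: G).

(** Exterior multiplication by e_j. *)
Definition kwedge j c G : V :=
  if j \in G then ksign j (G :\ j) *: c (G :\ j) else 0.

Definition kdeg (p : nat) c := forall G, #|G| != p -> c G = 0.

Lemma ksignU j l G : l \notin G ->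
  ksign j (l |: G) = (-1) ^+ (l < j)%N * ksign j G.
Proof. by move=> lG; rewrite /ksign big_setU1. Qed.

Lemma ksign_sq j G : ksign j G * ksign j G = 1.
Proof.
rewrite /ksign -big_split big1 //= => k _.
by rewrite -expr2 sqrr_sign.
Qed.

Lemma sign_swap j l : j != l -> (-1) ^+ (l < j)%N = - (-1) ^+ (j < l)%N :> R.
Proof.
by rewrite -val_eqE /=; case: ltngtP => //= _ _; rewrite ?expr0 ?expr1 ?opprK.
Qed.

Lemma kos_kos c G : kos (kos c) G = 0.
Proof.
pose F j l : V := if [&& j \notin G, l \notin G & j != l] then
  (ksign j G * ksign l G * (-1) ^+ (j < l)%N * (x j * x l)) *: c (l |: (j |: G))
  else 0.
rewrite -[RHS](@sum_antisym V n F).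
- rewrite /kos big_mkcond; apply: eq_bigr => j _; case: ifP => jG; last first.
    by rewrite big1 // => l _; rewrite /F jG.
  rewrite scaler_sumr big_mkcond; apply: eq_bigr => l _.
  rewrite /F jG in_setU1 negb_or eq_sym andbC /=; case: ifP => // /andP[lG jl].
  by rewrite scalerA ksignU //; congr (_ *: _); rewrite mulrCA; ring.
- by move=> j; rewrite /F eqxx !andbF.
- move=> j l; rewrite /F [RHS]fun_if oppr0 eq_sym andbCA; case: ifP => //.
  case/and3P=> jG lG jl; rewrite setUCA -scaleNr; congr (_ *: _).
  rewrite sign_swap // mulrN mulNr; congr (- _).
  by rewrite [x l * x j]mulrC; congr (_ * _ * _); rewrite mulrC.
Qed.

(** The homotopy that makes x_j act as 0 on Koszul homology. *)
Lemma kos_kwedge j c G :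
  kos (kwedge j c) G + kwedge j (kos c) G = x j *: c G.
Proof.
have termj (H : {set 'I_n}) : j \in H ->
    (ksign j (H :\ j) * ksign j (H :\ j) * x j) *: c (j |: (H :\ j)) = x j *: c H.
  by move=> jH; rewrite ksign_sq mul1r setD1K.
case: (boolP (j \in G)) => jG; last first.
  rewrite /kwedge (negPf jG) addr0 /kos (bigD1 j) //= big1 ?addr0.
    have jjG : (j |: G) :\ j = G by rewrite setU1K.
    by rewrite setU11 scalerA mulrAC jjG ksign_sq mul1r.
  by move=> l /andP[lG lj]; rewrite in_setU1 eq_sym (negPf lj) (negPf jG) scaler0.
rewrite [X in _ + X]/kwedge jG /kos [X in _ *: X](bigD1 j) ?setD11 //=.
rewrite scalerDr scalerA mulrA termj // addrCA -[RHS]addr0; congr (_ + _).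
have PG l : (l \notin G :\ j) && (l != j) = (l \notin G).
  rewrite !inE negb_and negbK; case: eqVneq => [->|]; first by rewrite jG.
  by rewrite andbT.
rewrite scaler_sumr (eq_bigl _ _ PG).
rewrite -big_split big1 //= => l lG.
have jl : j != l by apply: contraNneq lG => <-.
rewrite /kwedge in_setU1 jG orbT !scalerA.
have -> : (l |: G) :\ j = l |: G :\ j.
  by apply/setP => k; rewrite !inE; case: eqVneq => //= ->; rewrite (negPf jl).
have lGj : l \notin G :\ j by rewrite !inE (negPf lG) andbF.
rewrite (ksignU _ lGj) -scalerDl.
have -> : ksign l G = (-1) ^+ (j < l)%N * ksign l (G :\ j).
  by rewrite -ksignU ?setD11 // setD1K.
(* The two terms that exchange j and l cancel: moving e_j past e_l changes the
   sign. *)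
rewrite sign_swap 1?eq_sym //.
set s := (-1) ^+ _; have ss : s * s = 1 by rewrite -expr2 sqrr_sign.
rewrite (_ : _ + _ = (1 - s * s) * (ksign j (G :\ j) * ksign l (G :\ j) * x l)).
  by rewrite ss subrr mul0r scale0r.
ring.
Qed.

Lemma kos_comb r a b c : (forall G, c G = a G + r *: b G) ->
  forall G, kos c G = kos a G + r *: kos b G.
Proof.
move=> cE G; rewrite /kos scaler_sumr -big_split; apply: eq_bigr => j _ /=.
by rewrite cE scalerDr !scalerA; congr (_ + _ *: _); rewrite mulrC.
Qed.

Lemma eq_kos a b : a =1 b -> kos a =1 kos b.
Proof. by move=> ab G; apply: eq_bigr => j _; rewrite ab. Qed.

Lemma kos_sum (I : Type) (s : seq I) (P : pred I) (F : I -> {set 'I_n} -> V) G :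
  kos (fun G => \sum_(i <- s | P i) F i G) G = \sum_(i <- s | P i) kos (F i) G.
Proof.
rewrite /kos exchange_big /=; apply: eq_bigr => j _.
by rewrite scaler_sumr.
Qed.

(** Exterior multiplication by sum_j r_j e_j: a homotopy from 0 to
    multiplication by sum_j r_j x_j. *)
Definition khomotopy (r : 'I_n -> R) c G : V := \sum_j r j *: kwedge j c G.

Lemma kos_khomotopy r c G :
  kos (khomotopy r c) G + khomotopy r (kos c) G = (\sum_j r j * x j) *: c G.
Proof.
rewrite /khomotopy kos_sum -big_split scaler_suml; apply: eq_bigr => j _ /=.
rewrite -scalerA -kos_kwedge scalerDr; congr (_ + _).
rewrite -[RHS]add0r (@kos_comb (r j) (fun=> 0) (kwedge j c)).
  by rewrite /kos big1 // => l _; rewrite scaler0.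
by move=> H; rewrite add0r.
Qed.

Lemma khomotopy_comb r t a b c : (forall G, c G = a G + t *: b G) ->
  forall G, khomotopy r c G = khomotopy r a G + t *: khomotopy r b G.
Proof.
move=> cE G; rewrite /khomotopy scaler_sumr -big_split; apply: eq_bigr => j _ /=.
rewrite /kwedge; case: ifP => _; last by rewrite !scaler0 addr0.
by rewrite cE !scalerDr !scalerA; congr (_ + _ *: _); ring.
Qed.

Lemma kdeg_kos p c : kdeg p.+1 c -> kdeg p (kos c).
Proof.
move=> cp G Gp; rewrite /kos big1 // => j jG.
by rewrite cp ?scaler0 // cardsU1 jG.
Qed.

Lemma kos_kdeg0 c : kdeg 0 c -> forall G, kos c G = 0.
Proof.
move=> c0 G; rewrite /kos big1 // => j jG.
by rewrite c0 ?scaler0 // cardsU1 jG.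
Qed.

Lemma kdeg_kwedge p j c : kdeg p c -> kdeg p.+1 (kwedge j c).
Proof.
move=> cp G; rewrite /kwedge; case: ifP => // jG Gp.
by rewrite cp ?scaler0 //; rewrite (cardsD1 j) jG in Gp.
Qed.

Lemma kdeg_khomotopy p r c : kdeg p c -> kdeg p.+1 (khomotopy r c).
Proof.
move=> cp G Gp; rewrite /khomotopy big1 // => j _.
by rewrite (kdeg_kwedge j cp) ?scaler0.
Qed.

Lemma kdeg_comb p r a b c : (forall G, c G = a G + r *: b G) ->
  kdeg p a -> kdeg p b -> kdeg p c.
Proof. by move=> cE ap bp G Gp; rewrite cE ap ?bp // scaler0 addr0. Qed.

Lemma kdeg_sum p (I : Type) (s : seq I) (P : pred I) (F : I -> {set 'I_n} -> V) :
  (forall i, P i -> kdeg p (F i)) -> kdeg p (fun G => \sum_(i <- s | P i) F i G).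
Proof. by move=> Fp G Gp; rewrite big1 // => i Pi; apply: Fp. Qed.

Lemma kdeg_top c p : kdeg p c -> (n < p)%N -> forall G, c G = 0.
Proof.
move=> cp np G; apply: cp; rewrite neq_ltn (leq_ltn_trans _ np) //.
by rewrite -[X in (_ <= X)%N]card_ord max_card.
Qed.

Definition submod (J : V -> Prop) : Prop :=
  J 0 /\ forall r u v, J u -> J v -> J (u + r *: v).

Section Submod.
Variables (J : V -> Prop) (Jsub : submod J).

Lemma submod_sum (I : Type) (s : seq I) (P : pred I) (F : I -> V) :
  (forall i, P i -> J (F i)) -> J (\sum_(i <- s | P i) F i).
Proof.
move=> JF; elim/big_rec: _ => [|i v Pi Jv]; first by case: Jsub.
by rewrite addrC -[F i]scale1r; apply: Jsub.2 => //; apply: JF.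
Qed.

Lemma submodZ r v : J v -> J (r *: v).
Proof. by move=> Jv; rewrite -[_ *: _]add0r; apply: Jsub.2 => //; case: Jsub. Qed.

Lemma submodD u v : J u -> J v -> J (u + v).
Proof. by move=> Ju Jv; rewrite -[v]scale1r; apply: Jsub.2. Qed.

Lemma submodN u : J u -> J (- u).
Proof. by move=> Ju; rewrite -scaleN1r; apply: submodZ. Qed.

Lemma submodB u v : J u -> J v -> J (u - v).
Proof. by move=> Ju Jv; apply: submodD => //; apply: submodN. Qed.

Lemma submod_kos c : (forall G, J (c G)) -> forall G, J (kos c G).
Proof. by move=> Jc G; apply: submod_sum => j _; apply: submodZ. Qed.

Lemma submod_khomotopy r c : (forall G, J (c G)) -> forall G, J (khomotopy r c G).
Proof.
move=> Jc G; apply: submod_sum => j _; apply: submodZ.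
by rewrite /kwedge; case: ifP => _; [apply: submodZ | case: Jsub].
Qed.
End Submod.

(** Homology with coefficients in V/J is handled through representatives in V:
    cycles and boundaries are taken modulo J. *)
Definition kcycle (p : nat) (J : V -> Prop) c : Prop :=
  kdeg p c /\ forall G, J (kos c G).

Definition kbound (p : nat) (J : V -> Prop) c : Prop :=
  exists2 b, kdeg p.+1 b & forall G, J (c G - kos b G).

Definition kvanish (p : nat) (J : V -> Prop) : Prop :=
  forall c, kcycle p J c -> kbound p J c.

Lemma kbound_ext p (J J' : V -> Prop) a b : (forall v, J v <-> J' v) -> a =1 b ->
  kbound p J a -> kbound p J' b.
Proof.
by move=> JJ ab [d dp Jd]; exists d => // G; rewrite -ab -JJ.
Qed.

Lemma kbound_comb p J r a b c : submod J -> (forall G, c G = a G + r *: b G) ->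
  kbound p J a -> kbound p J b -> kbound p J c.
Proof.
move=> Js cE [a' a'p Ja] [b' b'p Jb].
have dE G : a' G + r *: b' G = a' G + r *: b' G by [].
exists (fun G => a' G + r *: b' G); first exact: kdeg_comb dE _ _.
move=> G; rewrite cE (kos_comb dE) opprD addrACA -scalerBr.
exact: Js.2.
Qed.

Lemma kbound_sub p J c : (forall G, J (c G)) -> kbound p J c.
Proof.
move=> Jc; exists (fun=> 0) => // G.
by rewrite /kos big1 ?subr0 // => j _; rewrite scaler0.
Qed.

Lemma kbound_sum p J (I : Type) (s : seq I) (P : pred I) F : submod J ->
  (forall i, P i -> kbound p J (F i)) ->
  kbound p J (fun G => \sum_(i <- s | P i) F i G).
Proof.
move=> Js bF; elim: s => [|i s IH].
  by apply: kbound_sub => G; rewrite big_nil; case: Js.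
case Pi: (P i); last by apply: kbound_ext IH => // G; rewrite big_cons Pi.
apply: (kbound_comb (r := 1) Js _ (bF i Pi) IH) => G.
by rewrite big_cons Pi scale1r.
Qed.

Lemma kvanish_top p (J : V -> Prop) : J 0 -> (n < p)%N -> kvanish p J.
Proof.
move=> J0 np c [cp _]; apply: kbound_sub => G.
by rewrite (kdeg_top cp np).
Qed.

End Koszul.

(** * Koszul homology modulo a regular element *)

Section Line.
Variables (n : nat) (R : comNzRingType) (V : lmodType R) (x : 'I_n -> R).
Variables (K : Type) (sc : K -> R).
Implicit Types (c e : {set 'I_n} -> V) (G : {set 'I_n}) (p : nat) (J : V -> Prop).

(** The homology of V/J in degree p is a line. The scalars act through an
    arbitrary map sc, because only the vanishing of the classes of c - (sc a)
    e matters. *)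
Definition kline p J : Prop :=
  exists e, [/\ kcycle x p J e, ~ kbound x p J e
    & forall c, kcycle x p J c ->
        exists a : K, kbound x p J (fun G => c G - sc a *: e G)].

Lemma kcycle_comb p J r a b c : submod J -> (forall G, c G = a G + r *: b G) ->
  kcycle x p J a -> kcycle x p J b -> kcycle x p J c.
Proof.
move=> Js cE [ap Ja] [bp Jb]; split; first exact: kdeg_comb cE ap bp.
by move=> G; rewrite (kos_comb x cE); apply: Js.2.
Qed.

(** The hypotheses say on representatives that phi induces an isomorphism in
    homology. *)
Lemma kline_transfer p p' J J' (phi : ({set 'I_n} -> V) -> {set 'I_n} -> V) :
  submod J -> submod J' ->
  (forall c, kcycle x p J c -> kcycle x p' J' (phi c)) ->
  (forall c, kbound x p J c -> kbound x p' J' (phi c)) ->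
  (forall c, kcycle x p J c -> kbound x p' J' (phi c) -> kbound x p J c) ->
  (forall c', kcycle x p' J' c' ->
     exists2 c, kcycle x p J c & kbound x p' J' (fun G => c' G - phi c G)) ->
  (forall c e a, phi (fun G => c G - sc a *: e G) =1
                 fun G => phi c G - sc a *: phi e G) ->
  kline p J <-> kline p' J'.
Proof.
move=> Js Js' phic phib phiI phiS phiL.
split=> [[e [ec eb eG]] | [e' [ec' eb' eG']]].
  exists (phi e); split; first exact: phic; first by move/phiI => /(_ ec).
  move=> c' /phiS[c cc bc]; have [a ba] := eG c cc; exists a.
  apply: (kbound_comb (r := 1) Js' _ bc (phib _ ba)) => G.
  by rewrite phiL scale1r addrA subrK.
have [e ec be] := phiS e' ec'.
exists e; split=> // [/phib be' | c cc].
  apply: eb'; apply: (kbound_comb (r := 1) Js' _ be be') => G.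
  by rewrite scale1r subrK.
have [a ba] := eG' _ (phic _ cc); exists a; apply: phiI.
  apply: (kcycle_comb (r := - sc a) Js _ cc ec) => G.
  by rewrite scaleNr.
apply: (kbound_comb (r := sc a) Js' _ ba be) => G.
by rewrite phiL scalerBr addrA subrK.
Qed.
End Line.

(** Multiplication by f is injective on V/J with cokernel V/J', and
    null-homotopic. The long exact sequence therefore splits into short ones,
    0 -> H_(p+1)(V/J) -> H_(p+1)(V/J') -> H_p(V/J) -> 0, and wedging with
    sum_j r_j e_j sends a cycle of V/J to a cycle of V/J' that the connecting
    map takes back to it. *)
Section RegularElement.
Variables (n : nat) (R : comNzRingType) (V : lmodType R) (x : 'I_n -> R).
Variables (J J' : V -> Prop) (f : R) (r : 'I_n -> R).
Hypotheses (Js : submod J) (J'E : forall v, J' v <-> exists u, J (v - f *: u)).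
Hypotheses (fE : f = \sum_j r j * x j).
Hypothesis f_reg : forall v, J (f *: v) -> J v.
Implicit Types (c e : {set 'I_n} -> V) (G : {set 'I_n}) (p : nat).

Lemma sub_J' v : J v -> J' v.
Proof. by move=> Jv; apply/J'E; exists 0; rewrite scaler0 subr0. Qed.

Lemma mulf_J' v : J' (f *: v).
Proof. by apply/J'E; exists v; rewrite subrr; case: Js. Qed.

Lemma submodJ' : submod J'.
Proof.
split; first by apply: sub_J'; case: Js.
move=> t u v /J'E[u' Ju] /J'E[v' Jv]; apply/J'E; exists (u' + t *: v').
have -> : u + t *: v - f *: (u' + t *: v') = (u - f *: u') + t *: (v - f *: v').
  rewrite scalerDr scalerBr !scalerA opprD addrACA; congr (_ + (_ - _ *: _)).
  exact: mulrC.
exact: Js.2.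
Qed.

Lemma khomotopy_cycle p e : kcycle x p J e -> kcycle x p.+1 J' (khomotopy r e).
Proof.
move=> [ep Je]; split; first exact: kdeg_khomotopy.
move=> G; have := kos_khomotopy x r e G; rewrite -fE => /(canRL (addrK _)) ->.
apply: (submodB submodJ'); first exact: mulf_J'.
exact/sub_J'/(submod_khomotopy Js).
Qed.

Lemma divide_J' p c : kdeg p c -> (forall G, J' (c G)) ->
  exists2 u, kdeg p u & forall G, J (c G - f *: u G).
Proof.
move=> cp /(_ _)/J'E cJ.
have [u uP] := choice _ cJ.
exists (fun G => if #|G| == p then u G else 0) => [G /negPf->//|G].
case: ifP => [_|/negbT /cp ->]; first exact: uP.
by rewrite scaler0 subrr; case: Js.
Qed.

Lemma khomotopy_inj p e : kcycle x p J e -> kbound x p.+1 J' (khomotopy r e) -> kbound x p J e.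
Proof.
move=> [ep Je] [b bp bJ].
have dE G : khomotopy r e G - kos x b G = khomotopy r e G + (-1) *: kos x b G.
  by rewrite scaleN1r.
have [] := @divide_J' p.+1 _ _ bJ.
  by apply: kdeg_comb dE _ _; [apply: kdeg_khomotopy | apply: kdeg_kos].
move=> u up uJ; exists u => // G; apply: f_reg.
have := submod_kos x Js uJ G.
have uE H : khomotopy r e H - kos x b H - f *: u H =
    (khomotopy r e H + (-1) *: kos x b H) + (- f) *: u H.
  by rewrite scaleN1r scaleNr.
rewrite (kos_comb x uE) (kos_comb x (fun=> erefl)) kos_kos scaler0 addr0.
have := kos_khomotopy x r e G; rewrite -fE => /(canRL (addrK _)) -> Ju.
rewrite scalerBr -scaleNr -(subrK (khomotopy r (kos x e) G) (f *: e G)) addrAC.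
by apply: submodD Ju _ => //; apply: submod_khomotopy.
Qed.

Lemma khomotopy_bound p e : kbound x p J e -> kbound x p.+1 J' (khomotopy r e).
Proof.
move=> [b bp bJ]; exists (fun G => - khomotopy r b G).
  by move=> G Gp; rewrite (kdeg_khomotopy r bp Gp) oppr0.
move=> G.
have nE H : - khomotopy r b H = 0 + (-1) *: khomotopy r b H by rewrite scaleN1r add0r.
rewrite (kos_comb x nE) scaleN1r opprD opprK.
have -> : kos x (fun=> 0 : V) G = 0.
  by rewrite /kos big1 // => j _; rewrite scaler0.
rewrite oppr0 add0r.
have := kos_khomotopy x r b G; rewrite -fE => /(canRL (addrK _)) ->.
rewrite addrCA; apply: (submodD submodJ'); first exact: mulf_J'.
apply: sub_J'; have := submod_khomotopy Js r bJ G.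
have dE H : e H - kos x b H = e H + (-1) *: kos x b H by rewrite scaleN1r.
by rewrite (khomotopy_comb r dE) scaleN1r.
Qed.

(** Modulo J the boundary of a cycle c of V/J' is f *: e; then e is a cycle,
    and c differs from the image of e by a cycle of V/J. *)
Lemma khomotopy_surj p c : kvanish x p.+1 J -> kcycle x p.+1 J' c ->
  exists2 e, kcycle x p J e & kbound x p.+1 J' (fun G => c G - khomotopy r e G).
Proof.
move=> van [cp cJ].
have [e ep eJ] := divide_J' (kdeg_kos x cp) cJ.
have dE (a b : {set 'I_n} -> V) t G : a G - t *: b G = a G + (- t) *: b G.
  by rewrite scaleNr.
have eC : kcycle x p J e.
  split=> // G; apply: f_reg; have := submod_kos x Js eJ G.
  rewrite (kos_comb x (dE _ _ f)) kos_kos add0r scaleNr => /(submodN Js).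
  by rewrite opprK.
exists e => //.
have cE G : c G - khomotopy r e G = c G + (-1) *: khomotopy r e G by rewrite scaleN1r.
have [|b bp bJ] := van (fun G => c G - khomotopy r e G).
  split; first by apply: kdeg_comb cE cp _; apply: kdeg_khomotopy.
  move=> G; rewrite (kos_comb x cE) scaleN1r.
  have := kos_khomotopy x r e G; rewrite -fE => /(canRL (addrK _)) ->.
  rewrite opprB addrCA addrC; apply: (submodD Js) (eJ G) _.
  by apply: (submod_khomotopy Js); case: eC.
by exists b => // G; apply: sub_J'.
Qed.

Lemma kvanish_descend p : kvanish x p.+1 J' -> kvanish x p J.
Proof. by move=> van e ec; apply: khomotopy_inj (ec) _; apply/van/khomotopy_cycle. Qed.

Lemma kvanish_ascend p : kvanish x p J -> kvanish x p.+1 J -> kvanish x p.+1 J'.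
Proof.
move=> v0 v1 c /(khomotopy_surj v1)[e /v0 eb cb].
apply: (kbound_comb (r := 1) submodJ' _ cb (khomotopy_bound eb)) => G.
by rewrite scale1r subrK.
Qed.

Lemma kline_regular (K : Type) (sc : K -> R) p : kvanish x p.+1 J ->
  kline x sc p J <-> kline x sc p.+1 J'.
Proof.
move=> van; apply: (kline_transfer (phi := khomotopy r)) => //.
- exact: submodJ'.
- exact: khomotopy_cycle.
- exact: khomotopy_bound.
- exact: khomotopy_inj.
- by move=> c' /(khomotopy_surj van).
- move=> c e a; have cE G : c G - sc a *: e G = c G + (- sc a) *: e G.
    by rewrite scaleNr.
  by move=> G; rewrite (khomotopy_comb r cE) scaleNr.
Qed.
End RegularElement.

(** * Noetherian rings and regular elements *)

Section Noetherian.
Variable R : comNzRingType.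

(** In this form the generators can be chosen inside any generating set of the
    ideal, which is what the finiteness of the set of maximal annihilators
    requires. *)
Definition noetherian : Prop := forall S : R -> Prop,
  exists2 s : seq R, forall g, g \in s -> S g
    & forall f, S f -> ideal_gen (fun g => g \in s) f.

Section Avoidance.
Hypothesis noethR : noetherian.
Variable J : R -> Prop.
Hypothesis Js : submod (V := R^o) J.

Lemma idealM a v : J v -> J (a * v).
Proof. exact: (submodZ (V := R^o) Js). Qed.

Lemma idealB u v : J u -> J v -> J (u - v).
Proof. exact: (submodB (V := R^o) Js). Qed.

Lemma ideal_gen_ann (S : R -> Prop) t g :
  (forall h, S h -> J (t * h)) -> ideal_gen S g -> J (t * g).
Proof.
move=> St [c cS ->]; rewrite mulr_sumr big_seq_cond.
apply: (submod_sum (V := R^o) Js) => p /andP[/cS/St Jp _].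
by rewrite mulrCA; apply: idealM.
Qed.

Definition sub_ann g h : Prop := forall t, J (t * g) -> J (t * h).

(** The annihilator of g in R/J is maximal among those of the nonzero classes,
    and therefore prime. *)
Definition max_ann g : Prop :=
  ~ J g /\ forall h, ~ J h -> sub_ann g h -> sub_ann h g.

(** An infinite strictly increasing chain of annihilators would give elements
    t_i, where t_i kills g_(i+1) but not g_i; finitely many of the t_i would
    generate all of them, and all lie in one annihilator of the chain. *)
Lemma max_ann_above h : ~ J h -> exists2 g, max_ann g & sub_ann h g.
Proof.
move=> Jh; apply: NNPP => noMax.
have up g : exists g', ~ J g /\ sub_ann h g ->
    (~ J g' /\ sub_ann h g') /\ sub_ann g g' /\ ~ sub_ann g' g.
  apply: NNPP => no; apply: (noMax); exists g.
    split=> [Jg | g' Jg' gg']; first by apply: no; exists g => -[].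
    apply: NNPP => g'g; apply: no; exists g' => -[_ hg]; split=> //.
    by split=> // t /hg/gg'.
  by apply: NNPP => hg; apply: no; exists g => -[].
have [nx nxP] := choice _ up.
pose g i := iter i nx h.
have gP i : ~ J (g i) /\ sub_ann h (g i).
  by elim: i => [|i /nxP[]//]; split=> // t.
have gS i : sub_ann (g i) (g i.+1) /\ ~ sub_ann (g i.+1) (g i).
  by have /nxP[] := gP i.
have g_mono i j : (i <= j)%N -> sub_ann (g i) (g j).
  move=> /subnK<-; elim: (j - i)%N => [|k IH] t // /IH.
  exact: (gS (k + i)%N).1.
have newt i : exists t, J (t * g i.+1) /\ ~ J (t * g i).
  apply: NNPP => no; apply: (gS i).2 => t tJ; apply: NNPP => tJ'.
  by apply: no; exists t.
have [t tP] := choice _ newt.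
have [s st sg] := noethR (fun f => exists i, f = t i).
have [N sN] : exists N, forall f, f \in s -> exists2 i, (i < N)%N & f = t i.
  elim: s st {sg} => [|f s IH] st; first by exists 0%N.
  have [|N sN] := IH; first by move=> f' f's; apply: st; rewrite inE f's orbT.
  have [i fi] := st f (mem_head _ _).
  exists (maxn N i.+1) => f'; rewrite inE => /orP[/eqP->|/sN[j jN ->]].
    by exists i => //; rewrite leq_max ltnSn orbT.
  by exists j => //; rewrite leq_max jN.
have tN : ideal_gen (fun f => f \in s) (t N) by apply: sg; exists N.
apply: (tP N).2; rewrite mulrC; apply: ideal_gen_ann tN => f /sN[i iN ->].
by rewrite mulrC; apply: (g_mono _ _ iN); apply: (tP i).1.
Qed.

Lemma max_ann_prime g a b : max_ann g -> J (a * b * g) -> ~ J (b * g) -> J (a * g).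
Proof.
move=> [Jg maxg] abg bg; apply: (maxg (b * g)) => //; last by rewrite mulrA.
by move=> t tg; rewrite mulrCA; apply: idealM.
Qed.

(** A prime that contains none of finitely many ideals does not contain their
    product. *)
Lemma max_ann_separate g (gs : seq R) : max_ann g ->
  (forall h, h \in gs -> ~ sub_ann h g) ->
  exists2 t, ~ J (t * g) & forall h, h \in gs -> J (t * h).
Proof.
move=> maxg; elim: gs => [|h gs IH] sep; first by exists 1; rewrite ?mul1r //; case: maxg.
have [|t tg tgs] := IH; first by move=> h' h'gs; apply: sep; rewrite inE h'gs orbT.
have [a [ah ag]] : exists a, J (a * h) /\ ~ J (a * g).
  apply: NNPP => no; apply: (sep h (mem_head _ _)) => a ah; apply: NNPP => ag.
  by apply: no; exists a.
exists (t * a) => [/(max_ann_prime maxg)/(_ ag)//|h'].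
rewrite inE => /orP[/eqP->|/tgs h't]; first by rewrite -mulrA; apply: idealM.
by rewrite mulrAC mulrC; apply: idealM.
Qed.

Variables (n : nat) (x : 'I_n -> R).
Hypothesis socle0 : forall v, (forall j, J (x j * v)) -> J v.

(** Prime avoidance. When the element f found for gs kills g, it is corrected
    by x_j t, where t lies in all annihilators of gs and neither t nor x_j
    kills g. *)
Lemma avoid_max_ann (gs : seq R) : (forall g, g \in gs -> max_ann g) ->
  exists r : 'I_n -> R, forall g, g \in gs -> ~ J ((\sum_j r j * x j) * g).
Proof.
elim: gs => [|g gs IH] maxgs; first by exists (fun=> 0).
have [|r rP] := IH; first by move=> h hgs; apply: maxgs; rewrite inE hgs orbT.
have maxg := maxgs g (mem_head _ _).
set f := \sum_j _ in rP.
have [fg | fg] := classic (J (f * g)); last first.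
  by exists r => h; rewrite inE => /orP[/eqP->|/rP].
have [|t tg tgs] := max_ann_separate (gs := gs) maxg.
  move=> h hgs hg; apply: (rP h hgs).
  have [_ maxh] : max_ann h by apply: maxgs; rewrite inE hgs orbT.
  by apply: (maxh g _ hg) fg; case: maxg.
have [j xjg] : exists j, ~ J (x j * g).
  apply: NNPP => no; apply: (proj1 maxg); apply: socle0 => j.
  by apply: NNPP => xjg; apply: no; exists j.
exists (fun k => r k + (if k == j then t else 0)) => h.
have -> : \sum_k (r k + (if k == j then t else 0)) * x k = f + t * x j.
  rewrite /f (eq_bigr _ (fun k _ => mulrDl _ _ _)) big_split /=; congr (_ + _).
  rewrite (bigD1 j) //= eqxx big1 ?addr0 // => k /negPf->.
  by rewrite mul0r.
rewrite mulrDl inE => /orP[/eqP-> | hgs] fth.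
  apply: tg; apply: (max_ann_prime maxg) xjg.
  by have := idealB fth fg; rewrite addrC addKr.
apply: (rP h hgs); have := idealB fth (idealM (x j) (tgs h hgs)).
by rewrite mulrA [x j * t]mulrC addrK.
Qed.

(** Every zero divisor on R/J lies in a maximal annihilator, and finitely many
    of these suffice: if gs generates the ideal of all g with maximal
    annihilator, the annihilator of such a g contains the intersection of
    those of gs, hence one of them. *)
Lemma exists_regular : exists r : 'I_n -> R,
  forall v, J ((\sum_j r j * x j) * v) -> J v.
Proof.
have [gs gsmax gsP] := noethR max_ann.
have [r rP] := avoid_max_ann gsmax.
set f := \sum_j _ in rP.
exists r => v fv; apply: NNPP => Jv.
have [g maxg vg] := max_ann_above Jv.
have [|t tg tgs] := max_ann_separate (gs := gs) maxg.
  move=> h hgs hg; apply: (rP h hgs).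
  by have [_ maxh] := gsmax h hgs; apply: maxh hg _ (vg f fv); case: maxg.
by apply: tg; apply: ideal_gen_ann (gsP g maxg) => h /tgs.
Qed.
End Avoidance.
End Noetherian.

(** * Dickson's lemma and the Hilbert basis theorem *)

Section IdealGen.
Variable R : comNzRingType.
Implicit Types (S J : R -> Prop).

Lemma submod_ideal_gen S : submod (V := R^o) (ideal_gen S).
Proof.
split=> [|r _ _ [c cS ->] [d dS ->]].
  by exists [::]; rewrite ?big_nil.
exists (c ++ [seq (r * p.1, p.2) | p <- d]).
  by move=> p; rewrite mem_cat => /orP[/cS//|/mapP[q /dS qS ->]].
rewrite big_cat big_map /=; congr (_ + _).
rewrite [LHS]/GRing.scale /= mulr_sumr.
by apply: eq_bigr => p _; rewrite mulrA.
Qed.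

Lemma ideal_gen_mem S f : S f -> ideal_gen S f.
Proof.
move=> Sf; exists [:: (1, f)]; last by rewrite big_seq1 mul1r.
by move=> p; rewrite inE => /eqP->.
Qed.

Lemma ideal_gen_min S J f : submod (V := R^o) J ->
  (forall g, S g -> J g) -> ideal_gen S f -> J f.
Proof.
move=> Js SJ Sf; rewrite -[f]mul1r; apply: (ideal_gen_ann Js) Sf => h /SJ.
by rewrite mul1r.
Qed.

Lemma ideal_gen_sub S S' f : (forall g, S g -> S' g) ->
  ideal_gen S f -> ideal_gen S' f.
Proof. by move=> SS' [c cS fE]; exists c => // p /cS/SS'. Qed.
End IdealGen.

Section Dickson.
Variables (n : nat).

(** By induction on the number k of coordinates that the comparison takes into
    account. A list L for the first k coordinates also handles the vectors
    whose next coordinate exceeds all those of L; the other values of that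
    coordinate are finite in number, and each of them is handled by a list of
    its own. *)
Lemma dickson (S : 'X_{1..n} -> Prop) : exists2 L : seq 'X_{1..n},
  forall l, l \in L -> S l & forall m, S m -> exists2 l, l \in L & (l <= m)%MM.
Proof.
suff main k : forall S : 'X_{1..n} -> Prop, exists2 L : seq 'X_{1..n},
    forall l, l \in L -> S l
    & forall m, S m -> exists2 l, l \in L & forall i : 'I_n, (i < k)%N -> (l i <= m i)%N.
  have [L LS Lm] := main n S; exists L => // m /Lm[l lL lm]; exists l => //.
  by apply/mnm_lepP => i; apply: lm.
elim: k => [|k IH] {}S.
  have [[m Sm] | noS] := classic (exists m, S m).
    by exists [:: m] => [l|m' _]; [rewrite inE => /eqP-> | exists m; rewrite ?mem_head].
  by exists [::] => // m Sm; case: noS; exists m.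
have [kn | nk] := ltnP k n; last first.
  have [L LS Lm] := IH S; exists L => // m /Lm[l lL lm]; exists l => // i _.
  by apply: lm; apply: leq_trans (ltn_ord i) nk.
pose k' := Ordinal kn.
have [L LS Lm] := IH S.
pose B := (\max_(l <- L) l k').+1.
have [F FP] : exists F : nat -> seq 'X_{1..n}, forall v,
    (forall l, l \in F v -> S l /\ l k' = v) /\ forall m, S m -> m k' = v ->
       exists2 l, l \in F v & forall i : 'I_n, (i < k)%N -> (l i <= m i)%N.
  apply: (choice (fun v (Fv : seq 'X_{1..n}) => (forall l, l \in Fv -> S l /\ l k' = v)
    /\ forall m, S m -> m k' = v -> exists2 l, l \in Fv
      & forall i : 'I_n, (i < k)%N -> (l i <= m i)%N)) => v.
  have [L' L'S L'm] := IH (fun l => S l /\ l k' = v).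
  by exists L'; split=> // m Sm mv; apply: L'm.
exists (L ++ flatten [seq F v | v <- iota 0 B]) => [l | m Sm].
  rewrite mem_cat => /orP[/LS//|/flatten_mapP[v _ lF]].
  by have [] := (FP v).1 l lF.
have lt_k1 (i : 'I_n) : (i < k.+1)%N -> i = k' \/ (i < k)%N.
  rewrite ltnS leq_eqVlt => /orP[/eqP ik|]; last by right.
  by left; apply: val_inj.
have [mB | mB] := ltnP (m k') B.
  have [l lF lm] := (FP (m k')).2 m Sm erefl.
  exists l => [|i /lt_k1[->|/lm//]]; last by have [_ ->] := (FP _).1 l lF.
  rewrite mem_cat; apply/orP; right; apply/flatten_mapP; exists (m k') => //.
  by rewrite mem_iota.
have [l lL lm] := Lm m Sm; exists l; first by rewrite mem_cat lL.
move=> i /lt_k1[->|/lm//]; apply: leq_trans mB; rewrite /B ltnW // ltnS.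
by apply: (leq_bigmax_seq (F := fun l : 'X_{1..n} => l k')).
Qed.
End Dickson.

Section HilbertBasis.
Variables (K : fieldType) (n : nat).
Local Notation P := {mpoly K[n]}.

(** By division, with elements of J whose leading monomials divide those of
    all elements of J. *)
Lemma ideal_fin_gen (J : P -> Prop) : submod (V := P^o) J ->
  exists2 s : seq P, forall g, g \in s -> J g
    & forall f, J f -> ideal_gen (fun g => g \in s) f.
Proof.
move=> Js.
have [L LJ Lm] := dickson (fun m => exists2 f, J f /\ f != 0 & mlead f = m).
have [F FP] : exists F : 'X_{1..n} -> P, forall l, l \in L ->
    [/\ J (F l), F l != 0 & mlead (F l) = l].
  apply: (choice (fun l (f : P) => l \in L -> [/\ J f, f != 0 & mlead f = l])) => l.
  have [/LJ[f [Jf f0] fl] | lL] := boolP (l \in L); first by exists f.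
  by exists 0.
exists [seq F l | l <- L] => [g /mapP[l lL ->] | f]; first by have [] := FP l lL.
elim/mleadrect: f => f IH Jf.
have [-> | f0] := eqVneq f 0; first by exact: (proj1 (submod_ideal_gen _)).
have [|l lL lef] := Lm (mlead f); first by exists f.
have [JFl Fl0 Fll] := FP l lL.
pose t := (mleadc f / mleadc (F l)) *: 'X_[mlead f - l].
have tf : mlead (t * F l) = mlead f.
  rewrite mleadM ?Fll // /t.
    rewrite mleadZ ?mleadXm ?submK //.
    by rewrite mulf_neq0 ?invr_eq0 ?mleadc_eq0.
  rewrite scaler_eq0 negb_or mulf_neq0 ?invr_eq0 ?mleadc_eq0 //=.
  by rewrite -mleadc_eq0 mleadXm mcoeffX eqxx oner_eq0.
have tc : (t * F l)@_(mlead f) = f@_(mlead f).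
  rewrite -{1}(submK lef) -Fll mleadcMW ?Fll //.
    rewrite /t mcoeffZ mcoeffX eqxx mulr1 Fll mulfVK //.
    by have := mleadc_eq0 (F l); rewrite Fll (negPf Fl0) => /negbT.
  by rewrite /t (le_trans (mleadZ_le _ _)) // mleadXm.
have gF : ideal_gen (fun g => g \in [seq F l | l <- L]) (t * F l).
  apply: (submodZ (V := P^o) (submod_ideal_gen _)).
  by apply: ideal_gen_mem; apply: map_f.
rewrite -(subrK (t * F l) f).
apply: (submodD (V := P^o) (submod_ideal_gen _)) => //.
have [-> | ft0] := eqVneq (f - t * F l) 0.
  by exact: (proj1 (submod_ideal_gen _)).
apply: IH; last by apply: (idealB Js) => //; apply: idealM.
rewrite lt_neqAle; apply/andP; split.
  apply: contraNneq ft0 => lE; rewrite -mleadc_eq0 lE mcoeffB tc subrr //.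
by apply: le_trans (mleadB_le _ _) _; rewrite tf joinxx.
Qed.

Lemma mpoly_noetherian : noetherian P.
Proof.
move=> S; have [s sS sgen] := ideal_fin_gen (submod_ideal_gen S).
suff [s' s'S s'gen] : exists2 s' : seq P, forall g, g \in s' -> S g
    & forall g, g \in s -> ideal_gen (fun g => g \in s') g.
  exists s' => // f Sf; apply: (ideal_gen_min (submod_ideal_gen _) s'gen).
  exact/sgen/ideal_gen_mem.
elim: s sS {sgen} => [|f s IH] sS; first by exists [::].
have [|s' s'S s'gen] := IH; first by move=> g gs; apply: sS; rewrite inE gs orbT.
have [c cS fE] := sS f (mem_head _ _).
exists ([seq p.2 | p <- c] ++ s').
  by move=> g; rewrite mem_cat => /orP[/mapP[p /cS pS ->]|/s'S].
move=> g; rewrite inE => /orP[/eqP->|/s'gen].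
  exists c => // p pc; rewrite mem_cat; apply/orP; left.
  by apply/mapP; exists p.
by apply: ideal_gen_sub => h hs'; rewrite mem_cat hs' orbT.
Qed.
End HilbertBasis.

(** * Depth and type through Koszul homology *)

Section Depth.
Variables (K : fieldType) (n : nat).
Local Notation P := {mpoly K[n]}.
Local Notation X := (fun j : 'I_n => 'X_j : P).
Implicit Types (J : P -> Prop) (s : seq P).

Definition ideal J : Prop := submod (V := P^o) J.
Definition koszul_vanish p J : Prop := kvanish (V := P^o) X p J.
Definition koszul_line p J : Prop := kline (V := P^o) X (@mpolyC n K) p J.

Lemma irrelevant_comb (f : P) : irrelevant f <-> exists r : 'I_n -> P, f = \sum_j r j * 'X_j.
Proof.
split=> [|[r ->]]; last first.
  apply: (submod_sum (submod_ideal_gen _)) => j _.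
  by apply: (submodZ (V := P^o) (submod_ideal_gen _)); apply: ideal_gen_mem; exists j.
pose L (f : P) := exists r : 'I_n -> P, f = \sum_j r j * 'X_j.
apply: (@ideal_gen_min _ _ L) => [|g [i ->]].
  split=> [|t _ _ [r ->] [r' ->]].
    by exists (fun=> 0); rewrite big1 // => j _; rewrite mul0r.
  exists (fun j => r j + t * r' j); rewrite [X in _ + X]/GRing.scale /= mulr_sumr.
  by rewrite -big_split; apply: eq_bigr => j _ /=; rewrite mulrDl mulrA.
exists (fun j => (j == i)%:R); rewrite (bigD1 i) //= eqxx mul1r big1 ?addr0 //.
by move=> j /negPf->; rewrite mul0r.
Qed.

Lemma mnm0_or (a : 'X_{1..n}) : a = 0%MM \/ exists j, a j != 0%N.
Proof.
have [/existsP[j aj] | /existsPn a0] := boolP [exists j, a j != 0%N].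
  by right; exists j.
by left; apply/mnmP => j; rewrite mnm0E; apply/eqP; rewrite -[_ == _]negbK a0.
Qed.

Lemma irrelevantE (f : P) : irrelevant f <-> f@_0%MM = 0.
Proof.
split=> [|f0].
  apply: (@ideal_gen_min _ _ (fun f : P => f@_0%MM = 0)) => [|g [i ->]].
    split=> [|t u v u0 v0]; first by rewrite mcoeff0.
    by rewrite mcoeffD u0 [t *: v]/GRing.scale /= (rmorphM (mcoeff 0%MM)) /= v0 mulr0 addr0.
  by rewrite mcoeffX mnm1_eq0.
rewrite (mpolyE f) big_seq_cond; apply: (submod_sum (submod_ideal_gen _)) => m.
rewrite andbT mcoeff_msupp => fm.
have [m0 | [i mi]] := mnm0_or m; first by rewrite m0 f0 eqxx in fm.
rewrite -(submK (m := U_(i)%MM) (m' := m)) ?lep1mP // mpolyXD scalerAl.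
by apply: (submodZ (V := P^o) (submod_ideal_gen _)); apply: ideal_gen_mem; exists i.
Qed.

Lemma irrelevant_proper : ~ irrelevant (1 : P).
Proof. by move/irrelevantE/eqP; rewrite mcoeff1 eqxx oner_eq0. Qed.

Lemma ideal_ideal_add J s : ideal (ideal_add J s).
Proof. exact: submod_ideal_gen. Qed.

Lemma ideal_add_nil J : ideal J -> forall v, ideal_add J [::] v <-> J v.
Proof.
move=> Js v; split=> [|Jv]; last by apply: ideal_gen_mem; left.
by apply: ideal_gen_min => // g [].
Qed.

Lemma ideal_add_rcons J s f v :
  ideal_add J (rcons s f) v <-> exists u, ideal_add J s (v - f * u).
Proof.
pose L v := exists u, ideal_add J s (v - f * u).
have Js := submod_ideal_gen (fun g => J g \/ g \in s).
split=> [|[u vu]].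
  apply: (@ideal_gen_min _ _ L) => [|g].
    split=> [|t u w [u' uu'] [w' ww']]; first by exists 0; rewrite mulr0 subr0; case: Js.
    exists (u' + t * w').
    have -> : u + t *: (w : P^o) - f * (u' + t * w') = (u - f * u') + t *: (w - f * w' : P^o).
      by rewrite /GRing.scale /=; ring.
    exact: Js.2.
  rewrite mem_rcons inE => gs; have [/eqP-> | gf] := boolP (g == f).
    by exists 1; rewrite mulr1 subrr; case: Js.
  exists 0; rewrite mulr0 subr0; apply: ideal_gen_mem.
  by case: gs => [|/orP[]]; [left | rewrite (negPf gf) | right].
have J's := submod_ideal_gen (fun g => J g \/ g \in rcons s f).
rewrite -(subrK (f * u) v); apply: (submodD (V := P^o) J's).
  apply: ideal_gen_sub vu => g [Jg|gs]; [by left | right].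
  by rewrite mem_rcons inE gs orbT.
rewrite mulrC; apply: (submodZ (V := P^o) J's).
by apply: ideal_gen_mem; right; rewrite mem_rcons mem_head.
Qed.

Lemma regular_rcons M J s f : regular_seq M J (rcons s f) <->
  [/\ regular_seq M J s, M f,
      forall g, ideal_add J s (f * g) -> ideal_add J s g
    & ~ ideal_add J (rcons s f) 1].
Proof.
have sub v : ideal_add J s v -> ideal_add J (rcons s f) v.
  by move=> Jv; apply/ideal_add_rcons; exists 0; rewrite mulr0 subr0.
have take_s i : (i <= size s)%N -> take i (rcons s f) = take i s.
  by move=> ?; rewrite -cats1 takel_cat.
split=> [[sM reg prop] | [[sM reg _] Mf regf prop]].
  split=> //.
  - split=> [g gs | i lis g | /sub//].
      by apply: sM; rewrite mem_rcons inE gs orbT.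
    by have := reg i _ g; rewrite size_rcons nth_rcons lis take_s 1?ltnW //; apply.
  - by apply: sM; rewrite mem_rcons mem_head.
  - move=> g; have := reg (size s) _ g; rewrite size_rcons nth_rcons ltnn eqxx.
    by rewrite take_s // take_size; apply.
split=> // [g | i]; first by rewrite mem_rcons inE => /orP[/eqP->|/sM].
rewrite size_rcons ltnS leq_eqVlt => /orP[/eqP-> | lis] g.
  by rewrite nth_rcons ltnn eqxx take_s // take_size; apply: regf.
by rewrite nth_rcons lis take_s 1?ltnW //; apply: reg.
Qed.

Lemma koszul_vanish_ext p J J' : (forall v, J v <-> J' v) ->
  koszul_vanish p J -> koszul_vanish p J'.
Proof.
move=> JJ van c [cp cJ]; have [|b bp bJ] := van c.
  by split=> // G; apply/JJ.
by exists b => // G; apply/JJ.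
Qed.

Lemma koszul_line_ext p J J' : (forall v, J v <-> J' v) -> koszul_line p J -> koszul_line p J'.
Proof.
move=> JJ [e [[ep eJ] eb eG]]; exists e; split.
- by split=> // G; apply/JJ.
- by move=> [b bp bJ]; apply: eb; exists b => // G; apply/JJ.
- move=> c [cp cJ]; have [|a [b bp bJ]] := eG c; first by split=> // G; apply/JJ.
  by exists a; exists b => // G; apply/JJ.
Qed.

Section RegularSequence.
Variables (J : P -> Prop) (Js : ideal J).
Local Notation m := (@irrelevant K n).

Lemma ideal_add_nilE v : J v <-> ideal_add J [::] v.
Proof. by apply: iff_sym; apply: ideal_add_nil. Qed.

Lemma regular_vanish s p : regular_seq m J s -> (n < p + size s)%N -> koszul_vanish p J.
Proof.
move=> reg np.
suff main q : (forall p, (q + size s <= p)%N -> koszul_vanish p (ideal_add J s)) ->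
    forall p, (q <= p)%N -> koszul_vanish p J.
  apply: (main p) => // p' pp'; apply: kvanish_top; first by case: (ideal_ideal_add J s).
  exact: leq_trans pp'.
elim/last_ind: s reg {np} => [_|s f IH /regular_rcons[reg mf regf _]] van p' qp'.
  apply: koszul_vanish_ext (van p' _); last by rewrite addn0.
  exact: ideal_add_nil.
apply: (IH reg) => // {qp'}p' qp'.
have [r fE] := (irrelevant_comb f).1 mf.
apply: (@kvanish_descend _ _ P^o X _ (ideal_add J (rcons s f)) f r) => //.
- exact: ideal_ideal_add.
- exact: ideal_add_rcons.
- by apply: van; rewrite size_rcons addnS ltnS.
Qed.

Lemma regular_vanish_up s q : regular_seq m J s ->
  (forall p, (q < p)%N -> koszul_vanish p J) ->
  forall p, (q + size s < p)%N -> koszul_vanish p (ideal_add J s).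
Proof.
move=> reg van; elim/last_ind: s reg => [_ p|s f IH /regular_rcons[reg mf regf _] p].
  by rewrite addn0 => /van; apply: koszul_vanish_ext => v; apply: ideal_add_nilE.
rewrite size_rcons addnS; case: p => // p; rewrite ltnS => qp.
have [r fE] := (irrelevant_comb f).1 mf.
apply: (@kvanish_ascend _ _ P^o X (ideal_add J s) _ f r) => //.
- exact: ideal_ideal_add.
- exact: ideal_add_rcons.
- exact: IH.
- by apply: IH => //; apply: ltnW.
Qed.

Lemma regular_line s q : regular_seq m J s ->
  (forall p, (q < p)%N -> koszul_vanish p J) ->
  koszul_line q J <-> koszul_line (q + size s) (ideal_add J s).
Proof.
move=> reg van; elim/last_ind: s reg => [_|s f IH /regular_rcons[reg mf regf _]].
  by rewrite addn0; split; apply: koszul_line_ext => v; rewrite ideal_add_nilE.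
rewrite IH // size_rcons addnS.
have [r fE] := (irrelevant_comb f).1 mf.
apply: (@kline_regular _ _ P^o X (ideal_add J s) _ f r) => //.
- exact: ideal_ideal_add.
- exact: ideal_add_rcons.
- by apply: (regular_vanish_up reg van).
Qed.

Hypothesis Jm : forall v, J v -> m v.

(** H_0(R/J) = R/(J + m) is not zero. *)
Lemma regular_len p : koszul_vanish p J -> (0 < p)%N.
Proof.
case: p => // van.
pose c (G : {set 'I_n}) : P^o := if G == set0 then 1 else 0.
have c0 : kdeg 0 c.
  by move=> G; rewrite /c cards_eq0 => /negPf->.
have [|b _ bJ] := van c.
  by split=> // G; rewrite (kos_kdeg0 X c0); case: Js.
case: irrelevant_proper.
have -> : 1 = (c set0 - kos X b set0) + kos X b set0 :> P.
  by rewrite /c eqxx subrK.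
apply: (submodD (V := P^o) (submod_ideal_gen _)); first exact: Jm.
apply: (submod_sum (submod_ideal_gen _)) => j _.
rewrite mulrC -scalerA; apply: ideal_gen_min (submod_ideal_gen _) _ _.
  by move=> g; apply: ideal_gen_mem.
rewrite [_ *: _]mulrC; apply: (submodZ (V := P^o) (submod_ideal_gen _)).
by apply: ideal_gen_mem; exists j.
Qed.

End RegularSequence.

Section Socle.
Variables (J : P -> Prop) (Js : ideal J).

(** The multiples of the top exterior power, whose homology is the socle. *)
Definition top_chain (v : P) (G : {set 'I_n}) : P^o := if G == setT then v else 0.

Lemma kdeg_top_chain v : kdeg n (top_chain v).
Proof.
move=> G Gn; rewrite /top_chain; case: eqP => // GT.
by rewrite GT cardsT card_ord eqxx in Gn.
Qed.

Lemma kcycle_top_chain v : (forall j : 'I_n, J ('X_j * v)) ->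
  kcycle (V := P^o) X n J (top_chain v).
Proof.
move=> vJ; split=> [|G]; first exact: kdeg_top_chain.
apply: (submod_sum Js) => j _; rewrite -scalerA; apply: (submodZ Js).
rewrite /top_chain; case: ifP => _; first exact: vJ.
by rewrite scaler0; case: Js.
Qed.

Lemma kcycle_top c (j : 'I_n) : kcycle (V := P^o) X n J c -> J ('X_j * c setT).
Proof.
move=> [cn cJ]; have := submodZ Js (ksign _ j (setT :\ j)) (cJ (setT :\ j)).
rewrite /kos (bigD1 j) ?setD11 //= big1 ?addr0; last first.
  by move=> l; rewrite !inE andbT negbK => /andP[->].
by rewrite setD1K // scalerA mulrA ksign_sq mul1r.
Qed.

Lemma kbound_top (c : {set 'I_n} -> P^o) : kdeg n c ->
  kbound (V := P^o) X n J c <-> J (c setT).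
Proof.
move=> cn; split=> [[b bn bJ] | cJ].
  have := bJ setT; rewrite /kos big1 ?subr0 // => j.
  by rewrite inE.
apply: kbound_sub => G; have [-> // | GT] := eqVneq G setT.
rewrite cn; first by case: Js.
apply: contraNneq GT => Gn; rewrite eqEcard subsetT cardsT card_ord Gn leqnn //.
Qed.

Lemma koszul_vanish_socle v : koszul_vanish n J -> (forall j : 'I_n, J ('X_j * v)) -> J v.
Proof.
move=> van /kcycle_top_chain/van/(kbound_top (kdeg_top_chain v)).
by rewrite /top_chain eqxx.
Qed.

Lemma in_socleE v : in_socle J v <-> forall j : 'I_n, J ('X_j * v).
Proof.
split=> [sv j | vJ g]; first by apply: sv; apply: ideal_gen_mem; exists j.
move/irrelevant_comb => [r ->]; rewrite mulr_suml.
apply: (submod_sum Js) => j _; rewrite -mulrA.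
exact: (submodZ Js).
Qed.

Lemma ideal_scale (a : K) v : J v -> J (a *: v).
Proof. by rewrite -mul_mpolyC; apply: (submodZ Js). Qed.

Lemma ideal_scale_inv (a : K) v : a != 0 -> J (a *: v) -> J v.
Proof.
by move=> a0 /(ideal_scale a^-1); rewrite scalerA mulVf // scale1r.
Qed.

Lemma koszul_line_socle : koszul_line n J <-> socle_dim J 1.
Proof.
have scE (a : K) (v : P) : (a%:MP : P) *: (v : P^o) = a *: v.
  exact: mul_mpolyC.
split=> [[e [ec eb eG]] | [b bs bG]].
  have eJ : ~ J (e setT) by move/(kbound_top ec.1).
  exists (fun=> e setT) => [_ | f /in_socleE fs].
    by apply/in_socleE => j; apply: kcycle_top ec.
  have [a ba] := eG _ (kcycle_top_chain fs).
  have fa : J (f - a *: e setT).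
    have /kbound_top : kdeg n (fun G => top_chain f G - (a%:MP : P) *: e G).
      move=> G Gn; rewrite (kdeg_top_chain f Gn).
      by rewrite (proj1 ec G Gn) scaler0 subr0.
    by move=> H; have := H.1 ba; rewrite /top_chain eqxx scE.
  exists (const_mx a); split=> [|c' Jc']; first by rewrite big_ord1 mxE.
  apply/rowP => i; rewrite mxE ord1; apply/eqP; rewrite eq_sym -subr_eq0.
  apply/negP => /negP ca; apply: eJ; apply: ideal_scale_inv ca _.
  have := submodB Js fa Jc'; rewrite big_ord1 opprB addrC addrA subrK.
  by rewrite scalerBl.
have bJ : ~ J (b ord0).
  move=> Jb; have [|c [_ cu]] := bG 0.
    by apply/in_socleE => j; rewrite mulr0; case: Js.
  have cE a : c = const_mx a.
    by apply: cu; rewrite big_ord1 mxE sub0r; apply: (submodN Js); apply: ideal_scale.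
  have := congr1 (fun c : 'rV_1 => c 0 0) (cE 0); rewrite (cE 1) !mxE => /eqP.
  by rewrite oner_eq0.
exists (top_chain (b ord0)); split.
- by apply: kcycle_top_chain; apply/in_socleE.
- by move/(kbound_top (kdeg_top_chain _)); rewrite /top_chain eqxx.
move=> c cc; have [|a [Ja _]] := bG (c setT).
  by apply/in_socleE => j; apply: kcycle_top cc.
exists (a 0 0); apply/kbound_top.
  move=> G Gn; rewrite (kdeg_top_chain _ Gn) scaler0 subr0.
  exact: cc.1.
by rewrite /top_chain eqxx scE; move: Ja; rewrite big_ord1.
Qed.
End Socle.

Section DepthTheorem.
Variables (J : P -> Prop) (Js : ideal J).
Local Notation m := (@irrelevant K n).
Hypothesis Jm : forall v, J v -> m v.

Lemma proper_add s : (forall f, f \in s -> m f) -> ~ ideal_add J s 1.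
Proof.
move=> sm J1; apply: (@irrelevant_proper).
by apply: ideal_gen_min J1 => [|g [/Jm|/sm]//]; apply: submod_ideal_gen.
Qed.

(** The top homology stays zero as long as fewer than k elements have been
    found, and it is the socle, so that the sequence can be extended. *)
Lemma vanish_regular k : (forall p, (n < p + k)%N -> koszul_vanish p J) ->
  exists2 s, regular_seq m J s & size s = k.
Proof.
move=> van.
have kn : (k <= n)%N.
  by rewrite leqNgt; apply/negP => nk; have /(regular_len Js Jm) := van 0%N nk.
suff main i : (i <= k)%N -> exists2 s, regular_seq m J s & size s = i.
  exact: main.
elim: i => [_|i IH ik].
  by exists [::] => //; split=> //; apply: proper_add.
have [s reg si] := IH (ltnW ik).
have vs : koszul_vanish n (ideal_add J s).
  apply: (regular_vanish_up Js reg (q := n - k)); last by rewrite si; lia.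
  by move=> p np; apply: van; lia.
have [r rreg] := exists_regular (@mpoly_noetherian K n) (ideal_ideal_add J s)
  (fun v => koszul_vanish_socle (ideal_ideal_add J s) vs).
exists (rcons s (\sum_j r j * 'X_j)); last by rewrite size_rcons si.
have mf : m (\sum_j r j * 'X_j) by apply/irrelevant_comb; exists r.
apply/regular_rcons; split=> //; apply: proper_add => f.
by rewrite mem_rcons inE => /orP[/eqP->//|]; case: reg => sm _ _ /sm.
Qed.

(** Depth sensitivity of the Koszul complex. *)
Lemma depth_geP k : (exists2 s, regular_seq m J s & size s = k) <->
  (forall p, (n < p + k)%N -> koszul_vanish p J).
Proof.
split=> [[s reg <-] p|]; [exact: regular_vanish | exact: vanish_regular].
Qed.

(** The maximal regular sequences have the length k for which H_(n - k) is the
    last nonzero homology, and the socle modulo such a sequence is isomorphic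
    to it. *)
Lemma cm_type1P : cm_type J 1 <-> exists k, [/\ (k <= n)%N,
  forall p, (n < p + k)%N -> koszul_vanish p J & koszul_line (n - k) J].
Proof.
split=> [[s [reg _] /(koszul_line_socle (ideal_ideal_add J s)) sl] | [k [kn van line]]].
  have van p := regular_vanish Js (p := p) reg.
  have kn : (size s <= n)%N.
    rewrite leqNgt; apply/negP => nk.
    by have /(regular_len Js Jm) := van 0%N nk.
  exists (size s); split=> //.
  apply/(regular_line Js reg); last by rewrite subnK.
  by move=> p np; apply: van; rewrite addnC -ltn_subLR.
have [s reg sk] := vanish_regular van.
have : koszul_line n (ideal_add J s).
  have := @regular_line J Js s (n - k) reg _; rewrite sk subnK // => H.
  by apply/H => // p np; apply: van; rewrite addnC -ltn_subLR.
move/(koszul_line_socle (ideal_ideal_add J s)) => soc.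
exists s => //; split=> // f /regular_rcons[_ mf regf _].
have Js' := ideal_ideal_add J s.
have /koszul_line_socle := soc => /(_ Js')[e [ec eb _]]; apply: eb.
apply/(kbound_top Js' ec.1); apply: regf.
have /(in_socleE Js') : forall j : 'I_n, ideal_add J s ('X_j * e setT).
  by move=> j; apply: kcycle_top ec.
by apply.
Qed.
End DepthTheorem.
End Depth.

(** * Multigraded pieces of the Koszul complex *)

Lemma regularZ (R : pzRingType) (r v : R) : r *: (v : R^o) = r * v.
Proof. by []. Qed.

Section Slices.
Variables (K : fieldType) (n : nat).
Local Notation P := {mpoly K[n]}.
Local Notation X := (fun j : 'I_n => 'X_j : P).
Local Notation Kcycle := (kcycle (V := P^o) X).
Local Notation Kbound := (kbound (V := P^o) X).
Implicit Types (a b m : 'X_{1..n}) (G : {set 'I_n}) (c : {set 'I_n} -> P^o)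
  (g : {set 'I_n} -> K^o).

Definition set_mnm G : 'X_{1..n} := [multinom (i \in G : nat) | i < n].

(** In multidegree a the variable x_j acts as 1 if a_j is nonzero; otherwise
    no set G with j in G contributes, and x_j counts as 0. *)
Definition supp_ind a (j : 'I_n) : K := (a j != 0%N)%:R.

(** The component of multidegree a: the generator e_G has multidegree G, so
    that its coefficient contributes through the monomial x^(a - G). *)
Definition slice a c G : K^o := if (set_mnm G <= a)%MM then (c G)@_(a - set_mnm G) else 0.

Definition unslice a g G : P^o :=
  if (set_mnm G <= a)%MM then ((g G : K) *: 'X_[a - set_mnm G] : P) else 0.

Lemma set_mnm_le a G : reflect (forall j, j \in G -> a j != 0%N) (set_mnm G <= a)%MM.
Proof.
apply: (iffP mnm_lepP) => H j; last first.
  by rewrite mnmE; have := H j; case: (j \in G) => // /(_ isT); rewrite lt0n.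
by have := H j; rewrite mnmE => + jG; rewrite jG lt0n.
Qed.

Lemma set_mnm_leU a j G : (set_mnm (j |: G) <= a)%MM = (a j != 0%N) && (set_mnm G <= a)%MM.
Proof.
apply/set_mnm_le/andP => [H | [aj /set_mnm_le H] k].
  split; first by apply: H; rewrite setU11.
  by apply/set_mnm_le => k kG; apply: H; rewrite inE kG orbT.
by rewrite !inE => /orP[/eqP->//|/H].
Qed.

Lemma set_mnmU a j G : j \notin G -> (a - set_mnm (j |: G) = a - set_mnm G - U_(j))%MM.
Proof.
move=> jG; apply/mnmP => k; rewrite !mnmE !inE.
by case: eqVneq => [->|jk]; rewrite ?(negPf jG) ?subn0 //= eq_sym ?(negPf jk) ?subn0 // eq_sym.
Qed.

Lemma sub_set_mnm a j G : j \notin G -> (a - set_mnm G)%MM j = a j.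
Proof. by move=> jG; rewrite !mnmE (negPf jG) subn0. Qed.

Lemma mcoeffXM (j : 'I_n) (p : P) m :
  ('X_j * p)@_m = if m j != 0%N then p@_(m - U_(j)) else 0.
Proof.
rewrite mulrC; case: ifP => mj.
  by rewrite -{1}(submK (m := U_(j)%MM) (m' := m)) ?lep1mP // addmC mcoeffMX.
apply/eqP; rewrite mcoeff_eq0 (perm_mem (msuppMX p _)).
apply/negP => /mapP[k _ mE]; move: mj.
by rewrite mE mnmDE mnm1E eqxx.
Qed.

Lemma ksignC (j : 'I_n) G : ksign P j G = (ksign K j G)%:MP.
Proof.
rewrite /ksign rmorph_prod; apply: eq_bigr => k _.
by rewrite rmorphXn rmorphN rmorph1.
Qed.

Lemma slice_kos a c : slice a (kos X c) =1 kos (supp_ind a) (slice a c).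
Proof.
move=> G; rewrite /slice; case: ifPn => aG; last first.
  rewrite [RHS]big1 // => j jG.
  by rewrite set_mnm_leU (negPf aG) andbF scaler0.
rewrite /kos raddf_sum /=; apply: eq_bigr => j jG.
rewrite set_mnm_leU aG andbT /supp_ind [_ *: c _]/GRing.scale /= ksignC.
rewrite -mulrA mul_mpolyC mcoeffZ mcoeffXM sub_set_mnm // set_mnmU //.
by case: ifP => _; rewrite /GRing.scale /= ?mulr1 ?mulr0 ?mul0r.
Qed.

Lemma kos_unslice a g : kos X (unslice a g) =1 unslice a (kos (supp_ind a) g).
Proof.
move=> G; rewrite /unslice; case: ifPn => aG; last first.
  rewrite [LHS]big1 // => j jG.
  by rewrite set_mnm_leU (negPf aG) andbF scaler0.
rewrite /kos scaler_suml; apply: eq_bigr => j jG.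
rewrite set_mnm_leU aG andbT /supp_ind ksignC; case: ifPn => aj; last first.
  by rewrite scaler0 mulr0 scale0r scale0r.
rewrite mulr1 regularZ -mulrA mul_mpolyC -scalerAr scalerA.
rewrite -mpolyXD set_mnmU // addmC submK //.
by rewrite lep1mP sub_set_mnm.
Qed.

Lemma eq_unslice a g g' : g =1 g' -> unslice a g =1 unslice a g'.
Proof. by move=> gg' G; rewrite /unslice gg'. Qed.

Lemma unslice0 a g G : (forall H, g H = 0) -> unslice a g G = 0.
Proof. by move=> g0; rewrite /unslice g0 scale0r if_same. Qed.

Lemma slice_unslice a b g G :
  slice b (unslice a g) G = if (set_mnm G <= a)%MM && (a == b) then g G else 0.
Proof.
rewrite /slice /unslice; have [<- | ab] := eqVneq a b.
  by case: ifP => aG; rewrite ?aG // mcoeffZ mcoeffX eqxx mulr1.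
rewrite andbF; case: ifPn => // bG; case: ifPn => aG; last by rewrite mcoeff0.
rewrite mcoeffZ mcoeffX; case: eqP => [abG|]; last by rewrite mulr0.
by case/eqP: ab; rewrite -(submK aG) abG submK.
Qed.

Lemma kdeg_unslice p a g : kdeg p g -> kdeg p (unslice a g).
Proof. by move=> gp G Gp; rewrite /unslice gp // scale0r if_same. Qed.

Lemma kdeg_slice p a c : kdeg p c -> kdeg p (slice a c).
Proof. by move=> cp G Gp; rewrite /slice cp // mcoeff0 if_same. Qed.

Definition chain_bound c (B : nat) : Prop :=
  forall G m, m \in msupp (c G) -> (mdeg (m + set_mnm G)%MM < B)%N.

Lemma chain_boundP c (B0 : nat) : exists2 B, (B0 <= B)%N & chain_bound c B.
Proof.
exists (B0 + \sum_G \sum_(m <- msupp (c G)) (mdeg (m + set_mnm G)%MM).+1)%N; first exact: leq_addr.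
move=> G m mc; rewrite (bigD1 G) //= (big_rem m) //=.
by apply: leq_trans (leq_addl _ _); rewrite -addnA; apply: leq_addr.
Qed.

Lemma unslice_sum c B : chain_bound c B -> forall G,
  c G = \sum_(a : 'X_{1..n < B}) unslice a (slice a c) G.
Proof.
move=> cB G; apply/mpolyP => m; rewrite raddf_sum /=.
have term a : a != (m + set_mnm G)%MM -> (unslice a (slice a c) G)@_m = 0.
  move=> am; rewrite /unslice; case: ifP => aG; last by rewrite mcoeff0.
  rewrite mcoeffZ mcoeffX; case: eqP => [aE|]; last by rewrite mulr0.
  by case/eqP: am; rewrite -aE submK.
have [mB | mB] := ltnP (mdeg (m + set_mnm G)%MM) B.
  rewrite (bigD1 (BMultinom mB)) //= big1 ?addr0; last first.
    move=> a am; apply: term; apply: contraNneq am => aE.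
    by apply/eqP; apply: val_inj.
  by rewrite /unslice /slice lem_addl addmK mcoeffZ mcoeffX eqxx mulr1.
rewrite big1 => [|a _]; last first.
  by apply: term; apply: contraTneq (bmdeg a) => ->; rewrite -leqNgt.
apply/eqP; rewrite mcoeff_eq0; apply/negP => /cB.
by rewrite ltnNge mB.
Qed.

Section MonomialIdeal.
Variables (I : P -> Prop) (U : 'X_{1..n} -> Prop).
Hypotheses (Is : ideal I) (IE : forall f, I f <-> forall m, m \in msupp f -> U m).

(** The slices of degree a of chains with values in I. *)
Definition slice_in a g : Prop :=
  forall G, (set_mnm G <= a)%MM -> g G != 0 -> U (a - set_mnm G)%MM.

Lemma unslice_in a g : slice_in a g -> forall G, I (unslice a g G).
Proof.
move=> gU G; rewrite /unslice; case: ifP => aG; last by case: Is.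
have [-> | gG] := eqVneq (g G) 0; first by rewrite scale0r; case: Is.
by apply/IE => m; rewrite msuppMCX // inE => /eqP->; apply: gU.
Qed.

Lemma in_slice a c : (forall G, I (c G)) -> slice_in a (slice a c).
Proof.
move=> cI G aG; rewrite /slice aG -mcoeff_msupp.
by move/IE: (cI G); apply.
Qed.

(** In such a degree division by x_j does not affect membership in I, and the
    complex of R/I is a cone over x_j. *)
Definition cone_degree a : Prop := exists2 j, a j != 0%N & forall G, j \notin G ->
  (set_mnm G <= a)%MM -> U (a - set_mnm G)%MM -> U (a - set_mnm (j |: G))%MM.

(** On the slice x_j acts as 1, so that wedging with e_j is a contracting
    homotopy; the cone condition makes it preserve the chains with values in
    I. *)
Lemma cone_bound p a c : cone_degree a -> Kcycle p I c ->
  Kbound p I (unslice a (slice a c)).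
Proof.
move=> [j aj jU] [cp cI].
exists (unslice a (kwedge j (slice a c))).
  exact/kdeg_unslice/kdeg_kwedge/kdeg_slice.
move=> G; rewrite kos_unslice.
have := unslice_in (a := a) (g := kwedge j (slice a (kos X c))) _ G.
rewrite {1}/slice_in => H.
have -> : unslice a (slice a c) G - unslice a (kos (supp_ind a) (kwedge j (slice a c))) G
   = unslice a (kwedge j (slice a (kos X c))) G.
  rewrite /unslice; case: ifP => _; last by rewrite subr0.
  transitivity ((slice a c G - kos (supp_ind a) (kwedge j (slice a c)) G : K)
                *: 'X_[a - set_mnm G] : P); first by rewrite scalerBl.
  apply: (congr1 (fun t : K => t *: 'X_[a - set_mnm G] : P)).
  have := kos_kwedge (supp_ind a) j (slice a c) G.
  rewrite {3}/supp_ind aj scale1r => {1}<-; rewrite addrAC subrr add0r.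
  by rewrite /kwedge; case: ifP => //; rewrite slice_kos.
apply: H => {}G aG; rewrite /kwedge; case: ifP => jG; last by rewrite eqxx.
rewrite scaler_eq0 negb_or => /andP[_ nz].
rewrite -(setD1K jG); apply: jU; first by rewrite setD11.
  by move: aG; rewrite -{1}(setD1K jG) set_mnm_leU => /andP[].
apply: (in_slice cI) nz.
by move: aG; rewrite -{1}(setD1K jG) set_mnm_leU => /andP[].
Qed.
End MonomialIdeal.

(** For the zero ideal every multidegree but 0 is a cone, and the slice of
    degree 0 only meets the empty set of variables. *)
Lemma koszul_exact p c : kdeg p.+1 c -> (forall G, kos X c G = 0) ->
  exists2 b, kdeg p.+2 b & forall G, c G = kos X b G.
Proof.
move=> cp c0; pose Z (f : P) := f = 0.
have Zs : ideal Z by split=> // r u v -> ->; rewrite scaler0 addr0.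
have ZE f : Z f <-> forall m, m \in msupp f -> False.
  split=> [->|f0]; first by move=> m; rewrite msupp0.
  by apply/mpolyP => m; rewrite mcoeff0; apply/eqP; rewrite mcoeff_eq0; apply/negP => /f0.
have [B _ cB] := chain_boundP c 0.
have cZ : Kcycle p.+1 Z c by [].
have [b bp bE] : Kbound p.+1 Z (fun G => \sum_(a : 'X_{1..n < B}) unslice a (slice a c) G).
  apply: kbound_sum => // a _; have [a0 | [j aj]] := mnm0_or (val a); last first.
    by apply: (cone_bound (U := fun _ => False)) => //; exists j.
  apply: kbound_sub => G; rewrite /unslice a0; case: set_mnm_le => // G0.
  rewrite /slice cp ?mcoeff0 ?if_same ?scale0r //.
  suff -> : G = set0 by rewrite cards0.
  by apply/setP => j; rewrite inE; apply/negP => /G0; rewrite mnm0E.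
exists b => // G; apply/eqP; rewrite -subr_eq0; apply/eqP.
by rewrite (unslice_sum cB); apply: bE.
Qed.
End Slices.

(** * Monomial ideals with the same multigraded pieces *)

Section Transport.
Variables (K : fieldType) (n : nat).
Local Notation P := {mpoly K[n]}.
Local Notation X := (fun j : 'I_n => 'X_j : P).
Local Notation Kcycle := (kcycle (V := P^o) X).
Local Notation Kbound := (kbound (V := P^o) X).
Implicit Types (a b m : 'X_{1..n}) (G : {set 'I_n}) (c : {set 'I_n} -> P^o)
  (U : 'X_{1..n} -> Prop) (I : P -> Prop).

Definition transport (ps : seq ('X_{1..n} * 'X_{1..n})) c G : P^o :=
  \sum_(q <- ps) unslice q.2 (slice q.1 c) G.

(** The pairs match multidegrees with the same Koszul complex, and the
    multidegrees that are not matched are acyclic for U. The same condition on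
    the swapped pairs controls U'. *)
Definition matched U U' (ps : seq ('X_{1..n} * 'X_{1..n})) : Prop :=
  [/\ uniq ps, {in ps &, injective (fun q => q.2)},
      forall q, q \in ps -> forall i, (q.1 i == 0%N) = (q.2 i == 0%N),
      forall q, q \in ps -> forall G, (set_mnm G <= q.1)%MM ->
        U (q.1 - set_mnm G)%MM <-> U' (q.2 - set_mnm G)%MM
    & forall a, a \notin [seq q.1 | q <- ps] -> cone_degree U a].

Definition swap_pairs (ps : seq ('X_{1..n} * 'X_{1..n})) := [seq (q.2, q.1) | q <- ps].

Definition monomial_pred I U : Prop := forall f, I f <-> forall m, m \in msupp f -> U m.

Lemma slice_comb (t : K) a c1 c2 c : (forall G, c G = c1 G + (t%:MP : P) *: c2 G) ->
  forall G, slice a c G = slice a c1 G + t * slice a c2 G.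
Proof.
move=> cE G; rewrite /slice; case: ifP => _; last by rewrite mulr0 addr0.
by rewrite cE mcoeffD regularZ mul_mpolyC mcoeffZ.
Qed.

Lemma slice_sum (T : Type) (s : seq T) (F : T -> {set 'I_n} -> P^o) a G :
  slice a (fun H => \sum_(i <- s) F i H) G = \sum_(i <- s) slice a (F i) G.
Proof.
rewrite /slice; case: ifP => _; last by rewrite big1.
exact: raddf_sum.
Qed.

Lemma slice_bound I p c : ideal I ->
  (forall a, Kbound p I (unslice a (slice a c))) -> Kbound p I c.
Proof.
move=> Is ba; have [B _ cB] := chain_boundP c 0.
apply: (@kbound_ext _ _ P^o X p I I (fun G => \sum_(a : 'X_{1..n < B}) unslice a (slice a c) G)).
- by [].
- by move=> G; rewrite [RHS](unslice_sum cB).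
- by apply: kbound_sum => // a _.
Qed.

Section OneWay.
Variables (U U' : 'X_{1..n} -> Prop) (I I' : P -> Prop) (ps : seq ('X_{1..n} * 'X_{1..n})).
Hypotheses (Is : ideal I) (IE : monomial_pred I U).
Hypotheses (I's : ideal I') (I'E : monomial_pred I' U').
Hypothesis mps : matched U U' ps.

Lemma set_mnm_le_pair q G : q \in ps -> (set_mnm G <= q.1)%MM = (set_mnm G <= q.2)%MM.
Proof.
case: mps => _ _ /[swap] _ /[swap] _ /[apply] q0.
by apply/set_mnm_le/set_mnm_le => H j /H; rewrite q0.
Qed.

Lemma pair_slice_in q (g : {set 'I_n} -> K^o) : q \in ps ->
  slice_in U q.1 g <-> slice_in U' q.2 g.
Proof.
move=> qps; case: mps => _ _ _ /(_ q qps) qU _.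
have le G := set_mnm_le_pair G qps.
split=> gU G qG gG; first by apply/qU; [rewrite le | apply: gU; rewrite ?le].
by apply/qU => //; apply: gU; rewrite -?le.
Qed.

Lemma kos_unslice_pair q c G : q \in ps ->
  kos X (unslice q.2 (slice q.1 c)) G = unslice q.2 (slice q.1 (kos X c)) G.
Proof.
move=> qps; rewrite kos_unslice; apply: eq_unslice => H.
rewrite slice_kos /kos; apply: eq_bigr => j _; rewrite /supp_ind.
by case: mps => _ _ /(_ q qps) -> _ _.
Qed.

Lemma kos_transport c G : kos X (transport ps c) G = transport ps (kos X c) G.
Proof.
rewrite /transport kos_sum big_seq [RHS]big_seq; apply: eq_bigr => q qps.
exact: kos_unslice_pair.
Qed.

Lemma kdeg_transport p c : kdeg p c -> kdeg p (transport ps c).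
Proof.
by move=> cp; apply: kdeg_sum => q _; apply: kdeg_unslice; apply: kdeg_slice.
Qed.

Lemma transport_in c : (forall G, I (c G)) -> forall G, I' (transport ps c G).
Proof.
move=> cI G; rewrite /transport big_seq; apply: (submod_sum I's) => q qps.
apply: (unslice_in I's I'E); apply/(pair_slice_in _ qps).
exact: (in_slice IE).
Qed.

Lemma transport_comb (t : K) c1 c2 c : (forall G, c G = c1 G + (t%:MP : P) *: c2 G) ->
  forall G, transport ps c G = transport ps c1 G + (t%:MP : P) *: transport ps c2 G.
Proof.
move=> cE G; rewrite /transport scaler_sumr -big_split; apply: eq_bigr => q _ /=.
rewrite /unslice; case: ifP => _; last by rewrite scaler0 addr0.
by rewrite (slice_comb _ cE) regularZ mul_mpolyC scalerA scalerDl.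
Qed.

(** The second components are distinct, so that no two pieces are moved to the
    same multidegree. *)
Lemma slice_transport q c : q \in ps -> slice q.2 (transport ps c) =1 slice q.1 c.
Proof.
move=> qps G; case: (mps) => Ups inj2 _ _ _.
rewrite /transport slice_sum (bigD1_seq q) //= big_seq_cond big1 ?addr0.
  rewrite slice_unslice eqxx andbT -set_mnm_le_pair //; case: ifPn => // qG.
  by rewrite /slice (negPf qG).
move=> q' /andP[q'ps q'q]; rewrite slice_unslice.
by case: eqP => [/inj2 E|_]; [rewrite E ?eqxx in q'q | rewrite andbF].
Qed.

Lemma kcycle_transport p c : Kcycle p I c -> Kcycle p I' (transport ps c).
Proof.
move=> [cp cI]; split; first exact: kdeg_transport.
by move=> G; rewrite kos_transport; apply: transport_in.
Qed.

Lemma kbound_transport p c : Kbound p I c -> Kbound p I' (transport ps c).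
Proof.
move=> [b bp bI]; exists (transport ps b); first exact: kdeg_transport.
have cE G : c G - kos X b G = c G + ((-1 : K)%:MP : P) *: kos X b G.
  by rewrite mpolyCN mpolyC1 scaleN1r.
move=> G; have := transport_in bI G.
by rewrite (transport_comb cE) mpolyCN mpolyC1 scaleN1r kos_transport.
Qed.

End OneWay.

Section TwoWays.
Variables (U U' : 'X_{1..n} -> Prop) (I I' : P -> Prop) (ps : seq ('X_{1..n} * 'X_{1..n})).
Hypotheses (Is : ideal I) (IE : monomial_pred I U).
Hypotheses (I's : ideal I') (I'E : monomial_pred I' U').
Hypotheses (mps : matched U U' ps) (mps' : matched U' U (swap_pairs ps)).

(** The difference of c and its image has zero slices in the matched degrees,
    and its other slices are boundaries. *)
Lemma transportK p c : Kcycle p I c ->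
  Kbound p I (fun G => c G - transport (swap_pairs ps) (transport ps c) G).
Proof.
move=> cc.
have dE G : c G - transport (swap_pairs ps) (transport ps c) G =
    c G + ((-1 : K)%:MP : P) *: transport (swap_pairs ps) (transport ps c) G.
  by rewrite mpolyCN mpolyC1 scaleN1r.
have dc : Kcycle p I (fun G => c G - transport (swap_pairs ps) (transport ps c) G).
  apply: (kcycle_comb Is dE cc).
  by apply: (kcycle_transport I'E Is IE mps'); apply: (kcycle_transport IE I's I'E mps).
apply: slice_bound => // a.
have [/mapP[q qps ->] | aps] := boolP (a \in [seq q.1 | q <- ps]); last first.
  by apply: (cone_bound Is IE) => //; case: mps => _ _ _ _; apply.
apply: kbound_sub => G; rewrite unslice0; first by case: Is.
move=> H; rewrite (slice_comb q.1 dE).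
have q'ps : (q.2, q.1) \in swap_pairs ps by apply/mapP; exists q.
rewrite (slice_transport mps' _ q'ps) (slice_transport mps _ qps) /=.
by rewrite mulN1r subrr.
Qed.

Lemma transport_inj p c : Kcycle p I c -> Kbound p I' (transport ps c) -> Kbound p I c.
Proof.
move=> cc /(kbound_transport I'E Is IE mps') cb.
apply: (kbound_comb (r := 1) Is _ (transportK cc) cb) => G.
by rewrite scale1r subrK.
Qed.

Lemma koszul_vanish_transport p : koszul_vanish p I' -> koszul_vanish p I.
Proof.
by move=> van c cc; apply: transport_inj => //; apply/van/(kcycle_transport IE I's I'E mps).
Qed.

End TwoWays.

Lemma swap_pairsK ps : swap_pairs (swap_pairs ps) = ps.
Proof. by rewrite /swap_pairs -map_comp -[RHS]map_id; apply: eq_map => -[]. Qed.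

Section Invariance.
Variables (U U' : 'X_{1..n} -> Prop) (I I' : P -> Prop) (ps : seq ('X_{1..n} * 'X_{1..n})).
Hypotheses (Is : ideal I) (IE : monomial_pred I U).
Hypotheses (I's : ideal I') (I'E : monomial_pred I' U').
Hypotheses (mps : matched U U' ps) (mps' : matched U' U (swap_pairs ps)).

Lemma koszul_vanish_matched p : koszul_vanish p I <-> koszul_vanish p I'.
Proof.
split; last exact: (koszul_vanish_transport Is IE I's I'E mps mps').
by apply: (koszul_vanish_transport I's I'E Is IE mps'); rewrite swap_pairsK.
Qed.

Lemma koszul_line_matched p : koszul_line p I <-> koszul_line p I'.
Proof.
apply: (kline_transfer (phi := transport ps)) => //.
- by move=> c; apply: (kcycle_transport IE I's I'E mps).
- by move=> c; apply: (kbound_transport IE I's I'E mps).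
- by move=> c; apply: (transport_inj Is IE I's I'E mps mps').
- move=> c' cc'; exists (transport (swap_pairs ps) c').
    exact: (kcycle_transport I'E Is IE mps').
  have := transportK I's I'E Is IE mps'.
  by rewrite swap_pairsK => /(_ mps p c' cc').
- move=> c e a; have cE G : c G - (a%:MP : P) *: e G = c G + ((- a)%:MP : P) *: e G.
    by rewrite mpolyCN scaleNr.
  by move=> G; rewrite (transport_comb _ cE) mpolyCN scaleNr.
Qed.
End Invariance.

(** The component of degree j of p e, where e is a generator of degree s. *)
Definition hcomp (s j : nat) (p : P) : P :=
  if (s <= j)%N then pihomog mdeg (j - s)%N p else 0.

Lemma mcoeff_hcomp s j p m :
  (hcomp s j p)@_m = if (s + mdeg m == j)%N then p@_m else 0.
Proof.
rewrite /hcomp; case: leqP => sj; last first.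
  by rewrite mcoeff0; case: eqP => // E; lia.
rewrite pihomogE raddf_sum /= (eq_bigr (fun k => p@_k * (k == m)%:R)); last first.
  by move=> k _; rewrite mcoeffZ mcoeffX.
rewrite big_mkcond /=.
have -> : (s + mdeg m == j)%N = (mdeg m == (j - s)%N).
  by apply/eqP/eqP => E; lia.
have [mp | mp] := boolP (m \in msupp p); last first.
  rewrite big_seq big1 => [|k kp]; last first.
    by case: eqP => // _; rewrite (_ : k == m = false) ?mulr0 //; apply: contraNF mp => /eqP<-.
  by move: mp; rewrite mcoeff_msupp negbK => /eqP->; rewrite if_same.
rewrite (bigD1_seq m) //= eqxx mulr1 big1 ?addr0 // => k km.
by rewrite (negPf km) mulr0 if_same.
Qed.

(** The part of total degree j of H_p(R/I) vanishes; e_G has degree #|G|. *)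
Definition graded_vanish p j I : Prop := forall c, Kcycle p I c ->
  Kbound p I (fun G => hcomp #|G| j (c G)).

Lemma mdeg_set_mnm G : mdeg (set_mnm G) = #|G|.
Proof.
rewrite mdegE -sum1_card [RHS]big_mkcond.
by apply: eq_bigr => i _; rewrite mnmE; case: (i \in G).
Qed.

Lemma mdegBm m a : (m <= a)%MM -> (mdeg m + mdeg (a - m))%N = mdeg a.
Proof. by move=> ma; rewrite -mdegD addmC submK. Qed.

Lemma slice_hcomp a j c :
  slice a (fun G => hcomp #|G| j (c G)) =1 fun G => if mdeg a == j then slice a c G else 0.
Proof.
move=> G; rewrite /slice; case: ifP => aG; last by rewrite if_same.
by rewrite mcoeff_hcomp -mdeg_set_mnm mdegBm.
Qed.

Lemma graded_slice p j I c : ideal I ->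
  (forall a, mdeg a = j -> Kbound p I (unslice a (slice a c))) ->
  Kbound p I (fun G => hcomp #|G| j (c G)).
Proof.
move=> Is ca; apply: slice_bound => // a.
have [aj | aj] := eqVneq (mdeg a) j.
  apply: kbound_ext (ca a aj) => // G; apply: eq_unslice => H.
  by rewrite slice_hcomp aj eqxx.
apply: kbound_sub => G; rewrite unslice0; first by case: Is.
by move=> H; rewrite slice_hcomp (negPf aj).
Qed.

Section GradedInvariance.
Variables (U U' : 'X_{1..n} -> Prop) (I I' : P -> Prop) (ps : seq ('X_{1..n} * 'X_{1..n})).
Hypotheses (Is : ideal I) (IE : monomial_pred I U).
Hypotheses (I's : ideal I') (I'E : monomial_pred I' U').
Hypotheses (mps : matched U U' ps) (mps' : matched U' U (swap_pairs ps)).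

Lemma graded_vanish_bound p j : (forall q, q \in ps -> mdeg q.1 != j) ->
  graded_vanish p j I.
Proof.
move=> psj c cc; apply: graded_slice => // a aj.
apply: (cone_bound Is IE) => //; case: mps => _ _ _ _; apply.
by apply/negP => /mapP[q /psj/eqP qj aq]; case: qj; rewrite -aq.
Qed.

(** A class of degree j splits into classes of multidegrees b with mdeg b = j;
    each is zero or comes from a multidegree a of at least the same total
    degree. *)
Lemma graded_vanish_le p j : (forall q, q \in ps -> (mdeg q.2 <= mdeg q.1)%N) ->
  (forall j', (j <= j')%N -> graded_vanish p j' I) -> graded_vanish p j I'.
Proof.
move=> leps van c cc; apply: graded_slice => // b bj.
have [/mapP[q' /mapP[q qps q'E] bq] | bps] := boolP (b \in [seq q.1 | q <- swap_pairs ps]);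
  last first.
  by apply: (cone_bound I's I'E) => //; case: mps' => _ _ _ _; apply.
have {bq q'E q'} bq : b = q.2 by rewrite bq q'E.
have eq1 := kos_unslice_pair mps' (q := (q.2, q.1)).
have q'ps : (q.2, q.1) \in swap_pairs ps by apply/mapP; exists q.
pose d := unslice q.1 (slice q.2 c).
have dc : Kcycle p I d.
  split; first by apply/kdeg_unslice/kdeg_slice; case: cc.
  move=> G; rewrite (eq1 _ _ q'ps) /=.
  apply: (unslice_in Is IE); apply/(pair_slice_in mps' _ q'ps) => /=.
  by apply: (in_slice I'E); case: cc.
have db : Kbound p I d.
  apply: kbound_ext (van (mdeg q.1) _ d dc) => [//|G|]; last by rewrite -bj bq; apply: leps.
  rewrite /d /unslice; case: ifP => qG; last first.
    by apply/mpolyP => m; rewrite mcoeff_hcomp mcoeff0 if_same.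
  apply/mpolyP => m; rewrite mcoeff_hcomp mcoeffZ mcoeffX.
  have [<-|] := eqVneq (q.1 - set_mnm G)%MM m; last by rewrite mulr0 if_same.
  by rewrite -mdeg_set_mnm mdegBm // eqxx.
apply: kbound_ext (kbound_transport IE I's I'E mps db) => // G.
have [Ups inj2 _ _ _] := mps.
rewrite /transport (bigD1_seq q) //= big_seq_cond big1 ?addr0 => [|q1 /andP[q1ps q1q]].
  rewrite bq; apply: eq_unslice => H; rewrite /d slice_unslice eqxx andbT.
  case: ifPn => // qH; rewrite /slice -(set_mnm_le_pair mps) //.
  by rewrite (negPf qH).
rewrite unslice0 // => H; rewrite /d slice_unslice; case: eqP => [E|_]; last by rewrite andbF.
have [_ inj1 _ _ _] := mps'; move: q1q.
have -> : q1 = q; last by rewrite eqxx.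
have q1'ps : (q1.2, q1.1) \in swap_pairs ps by apply/mapP; exists q1.
have [q12 q11] := inj1 _ _ q1'ps q'ps (esym E).
by rewrite [q1]surjective_pairing [q]surjective_pairing q12 q11.
Qed.
End GradedInvariance.
End Transport.

(** * Existence of minimal graded resolutions *)

Section Grading.
Variables (K : fieldType) (n : nat).
Local Notation P := {mpoly K[n]}.

Lemma hcomp_is_additive s j : zmod_morphism (@hcomp K n s j).
Proof.
move=> p q; apply/mpolyP => m; rewrite mcoeffB !mcoeff_hcomp mcoeffB.
by case: ifP => _; rewrite ?subr0.
Qed.

HB.instance Definition _ s j :=
  GRing.isZmodMorphism.Build P P (@hcomp K n s j) (hcomp_is_additive s j).

Lemma hcomp_homog s j d (p : P) : p \is d.-homog ->
  hcomp s j p = if (s + d == j)%N then p else 0.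
Proof.
move=> pd; apply/mpolyP => m; rewrite mcoeff_hcomp.
have [md | md] := eqVneq (mdeg m) d.
  by rewrite md; case: ifP; rewrite ?mcoeff0.
have p0 : p@_m = 0 by apply: dhomog_nemf_coeff pd md.
by rewrite p0; case: ifP; case: ifP; rewrite ?p0 ?mcoeff0.
Qed.

Lemma hcomp_sum s (p : P) B : (s + msize p <= B)%N -> p = \sum_(j < B) hcomp s j p.
Proof.
move=> pB; apply/mpolyP => m; rewrite raddf_sum /=.
have [mp | mp] := boolP (m \in msupp p); last first.
  have p0 : p@_m = 0 by apply/eqP; rewrite mcoeff_eq0.
  by rewrite p0 big1 // => j _; rewrite mcoeff_hcomp p0 if_same.
have smB : (s + mdeg m < B)%N.
  by apply: leq_trans pB; rewrite ltn_add2l; apply: msize_mdeg_lt.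
rewrite (bigD1 (Ordinal smB)) //= mcoeff_hcomp eqxx big1 ?addr0 // => j jm.
rewrite mcoeff_hcomp; case: eqP => // jE; case/eqP: jm.
exact/val_inj/esym.
Qed.

Lemma hcomp_mul s e j (p g : P) : g \is e.-homog ->
  hcomp s j (p * g) = hcomp (s + e) j p * g.
Proof.
move=> ge; rewrite {1}[p](pihomog_partitionE (k := msize p) (leqnn _)).
rewrite [in RHS](pihomog_partitionE (k := msize p) (leqnn _)).
rewrite mulr_suml !raddf_sum /= mulr_suml; apply: eq_bigr => d _.
have pd : pihomog mdeg d p \is d.-homog by apply: pihomogP.
rewrite (hcomp_homog _ _ (dhomogM pd ge)) (hcomp_homog _ _ pd).
by rewrite -addnA [(e + d)%N]addnC; case: ifP => _; rewrite ?mul0r.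
Qed.

Definition row_component r (sh : 'I_r -> nat) j (v : 'rV[P]_r) : 'rV[P]_r :=
  \row_k hcomp (sh k) j (v 0 k).

Definition homog_mx r' r (sh' : 'I_r' -> nat) (sh : 'I_r -> nat) (D : 'M[P]_(r', r)) :=
  forall k l, D k l != 0 -> exists2 e : nat, sh' k = (sh l + e)%N & D k l \is e.-homog.

Lemma row_component_mul r' r sh' sh (D : 'M[P]_(r', r)) j w : homog_mx sh' sh D ->
  row_component sh j (w *m D) = row_component sh' j w *m D.
Proof.
move=> Dh; apply/rowP => l; rewrite !mxE raddf_sum; apply: eq_bigr => k _ /=.
have [-> | /Dh[e eE De]] := eqVneq (D k l) 0; first by rewrite !mulr0 raddf0.
by rewrite mxE eE (hcomp_mul _ _ _ De).
Qed.

Lemma row_component_sum r (sh : 'I_r -> nat) (v : 'rV[P]_r) B :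
  (forall k, sh k + msize (v ord0 k) <= B)%N -> v = \sum_(j < B) row_component sh j v.
Proof.
move=> vB; apply/rowP => k; rewrite summxE [LHS](hcomp_sum (vB k)).
by apply: eq_bigr => j _; rewrite mxE.
Qed.
End Grading.

Section FiniteGeneration.
Variables (K : fieldType) (n : nat).
Local Notation P := {mpoly K[n]}.

Lemma ideal_gen_seq (s : seq P) f : ideal_gen (fun g => g \in s) f ->
  exists w : 'rV[P]_(size s), f = \sum_i w 0 i * s`_i.
Proof.
apply: (@ideal_gen_min _ _ (fun f => exists w : 'rV[P]_(size s), f = \sum_i w 0 i * s`_i)).
  split=> [|r _ _ [u ->] [w ->]].
    by exists 0; rewrite big1 // => i _; rewrite mxE mul0r.
  exists (u + r *: w); rewrite regularZ mulr_sumr -big_split.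
  by apply: eq_bigr => i _; rewrite !mxE mulrDl mulrA.
move=> g; rewrite -index_mem => gs.
exists (delta_mx 0 (Ordinal gs)); rewrite (bigD1 (Ordinal gs)) //= mxE !eqxx mul1r.
rewrite nth_index -?index_mem // big1 ?addr0 // => i ig.
by rewrite mxE (negPf ig) andbF mul0r.
Qed.

Lemma submod_mul r t (N : 'rV[P]_r -> Prop) (D : 'M[P]_(t, r)) w : submod N ->
  (forall k, N (row k D)) -> N (w *m D).
Proof.
move=> Ns ND; rewrite mulmx_sum_row; apply: (submod_sum Ns) => k _.
exact: submodZ.
Qed.

(** The first coordinates of the elements of N form an ideal; lifts of its
    generators reduce N to the elements with first coordinate 0. *)
Lemma row_module_fin_gen r (N : 'rV[P]_r -> Prop) : submod N ->
  exists t (D : 'M[P]_(t, r)), (forall k, N (row k D)) /\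
    forall v, N v -> exists w, v = w *m D.
Proof.
elim: r N => [|r IH] N Ns.
  exists 0%N, 0; split=> [[]//|v _]; exists 0.
  by rewrite [v]thinmx0 [RHS]thinmx0.
pose J (f : P) := exists u : 'rV[P]_r, N (row_mx f%:M u : 'rV_(1 + r)).
have Js : ideal J.
  split=> [|a f g [u Nu] [w Nw]].
    exists 0; rewrite (_ : row_mx _ _ = 0) ?row_mx0; first by case: Ns.
    by rewrite (_ : 0%:M = 0) ?row_mx0 //; apply/matrixP => i l; rewrite !mxE mul0rn.
  exists (u + a *: w).
  have -> : row_mx (f + a *: g)%:M (u + a *: w) =
      row_mx f%:M u + a *: row_mx g%:M w :> 'rV_(1 + r).
    by rewrite scale_row_mx add_row_mx regularZ raddfD /= scale_scalar_mx.
  exact: Ns.2.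
have [s sJ sgen] := ideal_fin_gen Js.
have lift (i : 'I_(size s)) : exists u : 'rV[P]_r, N (row_mx (s`_i)%:M u : 'rV_(1 + r)).
  by apply: sJ; apply: mem_nth.
have [u Nu] := choice _ lift.
pose L : 'M[P]_(size s, 1 + r) := \matrix_i row_mx (s`_i)%:M (u i).
have NL k : N (row k L) by rewrite rowK; apply: Nu.
have [|t [D [ND Dgen]]] := IH (fun w => N (row_mx 0 w : 'rV_(1 + r))).
  split; first by rewrite row_mx0; case: Ns.
  move=> a v w Nv Nw.
  have -> : row_mx 0 (v + a *: w) =
      row_mx (0 : 'M[P]_1) v + a *: row_mx 0 w :> 'rV_(1 + r).
    by rewrite scale_row_mx add_row_mx scaler0 addr0.
  exact: Ns.2.
exists (size s + t)%N, (col_mx L (row_mx 0 D)).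
have NC k : N (row k (col_mx L (row_mx 0 D))).
  rewrite -(splitK k); case: (split k) => i /=; first by rewrite rowKu.
  by rewrite rowKd row_row_mx row0; apply: ND.
split=> // v Nv.
pose v' : 'rV_(1 + r) := v.
have vE : v' = row_mx (v' 0 0)%:M (rsubmx v').
  rewrite -[LHS]hsubmxK; congr row_mx; apply/rowP => i.
  by rewrite !mxE !ord1 eqxx mulr1n; congr (v' _ _); apply: val_inj.
have [w wE] : exists w : 'rV[P]_(size s), v' 0 0 = \sum_i w 0 i * s`_i.
  by apply/ideal_gen_seq/sgen; exists (rsubmx v'); rewrite -vE.
have wL : w *m L = row_mx (v' 0 0)%:M (rsubmx (w *m L)).
  rewrite -[LHS]hsubmxK; congr row_mx; apply/rowP => i.
  rewrite !mxE !ord1 eqxx mulr1n wE; apply: eq_bigr => k _.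
  by rewrite !mxE; case: splitP => // l _; rewrite !mxE !ord1 eqxx.
have : N (v' - w *m L) by apply: submodB => //; apply: submod_mul.
rewrite {1}vE wL opp_row_mx add_row_mx subrr => /Dgen[w0 w0E].
have DE : w0 *m (row_mx 0 D : 'M_(t, 1 + r)) = row_mx 0 (w0 *m D).
  by rewrite mul_mx_row mulmx0.
exists (row_mx w w0); rewrite mul_row_col [X in _ + X]DE -w0E.
rewrite -[v]/v' -[LHS](subrK (w *m L)) addrC; congr (_ + _).
by rewrite {1}vE {1}wL opp_row_mx add_row_mx subrr.
Qed.

Definition homog_gen r (sh : 'I_r -> nat) (N : 'rV[P]_r -> Prop) (t : nat) : Prop :=
  exists (sh' : 'I_t -> nat) (D : 'M[P]_(t, r)),
    homog_mx sh' sh D /\ forall v, N v <-> exists w, v = w *m D.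

Lemma ex_min_nat (Q : nat -> Prop) : (exists t, Q t) ->
  exists2 t, Q t & forall t', (t' < t)%N -> ~ Q t'.
Proof.
move=> [t Qt]; apply: NNPP => no.
have : forall t', (t' <= t)%N -> ~ Q t'; last by move/(_ t (leqnn _)).
elim: {Qt}t => [|t IH] t' t't Qt'; apply: no; exists t' => // s st.
  by move: t't; rewrite leqNgt (leq_ltn_trans _ st).
by apply: IH; rewrite -ltnS; apply: leq_trans st t't.
Qed.

Lemma homog_gen_ex r (sh : 'I_r -> nat) (N : 'rV[P]_r -> Prop) : submod N ->
  (forall j v, N v -> N (row_component sh j v)) -> exists t, homog_gen sh N t.
Proof.
move=> Ns Ngr; have [t [D [ND Dgen]]] := row_module_fin_gen Ns.
(* The entries of D have no component of degree B or more. *)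
pose B := (\sum_i \sum_k (sh k + msize (D i k)))%N.
pose T : finType := ('I_t * 'I_B)%type.
pose ev (k : 'I_#|T|) : T := enum_val k.
pose E : 'M[P]_(#|T|, r) := \matrix_k row_component sh (ev k).2 (row (ev k).1 D).
exists #|T|, (fun k => nat_of_ord (ev k).2), E; split.
  move=> k l; rewrite !mxE /hcomp; case: leqP => [le | _]; last by rewrite eqxx.
  move=> _; exists ((ev k).2 - sh l)%N; first by rewrite subnKC.
  exact: pihomogP.
move=> v; split=> [/Dgen[w ->] | [w ->]]; last first.
  by apply: submod_mul => // k; rewrite rowK; apply: Ngr.
exists (\row_k w 0 (ev k).1); rewrite !mulmx_sum_row.
transitivity (\sum_(q : T) w 0 q.1 *: row_component sh q.2 (row q.1 D)); last first.
  rewrite (reindex ev) /=; last exact/onW_bij/enum_val_bij.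
  by apply: eq_bigr => k _; rewrite mxE rowK.
rewrite -(pair_bigA _ (fun i (j : 'I_B) => w 0 i *: row_component sh j (row i D))) /=.
apply: eq_bigr => i _; rewrite -scaler_sumr; congr (_ *: _).
apply: row_component_sum => k; rewrite mxE /B (bigD1 i) //= (bigD1 k) //=.
by rewrite -addnA leq_addr.
Qed.

(** With the least number of generators, a relation cannot have a coefficient
    with nonzero constant term: its component in the degree of that generator
    would express the generator through the others. *)
Lemma min_homog_gen r (sh : 'I_r -> nat) (N : 'rV[P]_r -> Prop) : submod N ->
  (forall j v, N v -> N (row_component sh j v)) ->
  exists t (sh' : 'I_t -> nat) (D : 'M[P]_(t, r)),
    [/\ homog_mx sh' sh D, forall v, N v <-> exists w, v = w *m D
      & forall (w : 'rV_t) k, w *m D = 0 -> irrelevant (w 0 k)].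
Proof.
move=> Ns Ngr; have [t [sh' [D [Dh Dgen]]] tmin] := ex_min_nat (homog_gen_ex Ns Ngr).
exists t, sh', D; split=> // w k wD; apply/irrelevantE; apply/eqP; apply: contraT => wk.
pose w' := row_component sh' (sh' k) w.
have w'D : w' *m D = 0.
  by rewrite -(row_component_mul _ _ Dh) wD; apply/rowP => l; rewrite !mxE raddf0.
have w'k : w' 0 k = ((w 0 k)@_0%MM)%:MP.
  rewrite mxE; apply/mpolyP => m; rewrite mcoeff_hcomp mcoeffC.
  rewrite -{2}[sh' k]addn0 eqn_add2l mdeg_eq0 eq_sym.
  by case: eqP => [<-|_]; rewrite ?mulr1 ?mulr0.
move: t sh' D Dh Dgen tmin w k wD wk w' w'D w'k => [|t] sh' D Dh Dgen tmin w k wD wk w' w'D w'k.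
  by case: k {wk w'k}.
case: (tmin t (ltnSn t)); exists (fun i => sh' (lift k i)), (row' k D).
split=> [i l | v]; first by rewrite !mxE; apply: Dh.
have row_row' i : row i (row' k D) = row (lift k i) D.
  by apply/rowP => l; rewrite !mxE.
rewrite Dgen; split=> [[u ->] | [u ->]]; last first.
  exists (\row_i if unlift k i is Some i' then u 0 i' else 0).
  rewrite !mulmx_sum_row (bigD1_ord k) //= mxE unlift_none scale0r add0r.
  by apply: eq_bigr => i _; rewrite mxE liftK row_row'.
pose c := u 0 k * ((w 0 k)@_0%MM)^-1%:MP.
have uk : (u - c *: w') 0 k = 0.
  by rewrite !mxE -/(w' 0 k) w'k /c -mulrA -mpolyCM mulVf // mpolyC1 mulr1 subrr.
exists (\row_i (u - c *: w') 0 (lift k i)).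
have -> : u *m D = (u - c *: w') *m D by rewrite mulmxBl -scalemxAl w'D scaler0 subr0.
rewrite !mulmx_sum_row (bigD1_ord k) //= uk scale0r add0r.
by apply: eq_bigr => i _; rewrite mxE row_row'.
Qed.
End FiniteGeneration.

Section Resolution.
Variables (K : fieldType) (n : nat).
Local Notation P := {mpoly K[n]}.

(** A graded submodule of a graded free module, contained in m times that
    module: what remains to be resolved. The kernel of a minimal cover is
    again of this form. *)
Record stage := Stage {
  stage_rk : nat;
  stage_shift : 'I_stage_rk -> nat;
  stage_mod : 'rV[P]_stage_rk -> Prop;
  stage_submod : submod stage_mod;
  stage_graded : forall j v, stage_mod v -> stage_mod (row_component stage_shift j v);
  stage_min : forall v k, stage_mod v -> irrelevant (v 0 k) }.

Definition covers (s t : stage) (D : 'M[P]_(stage_rk t, stage_rk s)) : Prop :=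
  [/\ homog_mx (@stage_shift t) (@stage_shift s) D,
      forall v, stage_mod v <-> exists w, v = w *m D
    & forall w, stage_mod w <-> w *m D = 0].

(** The cover is kept as data, since the resolution is built from these
    choices. *)
Lemma next_stage (s : stage) : {t : stage & {D | covers (s := s) (t := t) D}}.
Proof.
have ex_t : exists t, exists D, covers (s := s) (t := t) D.
  have [t [sh [D [Dh Dgen Dmin]]]] := min_homog_gen (stage_submod s) (@stage_graded s).
  have kers : submod (fun w : 'rV[P]_t => w *m D = 0).
    split=> [|r u v u0 v0]; first exact: mul0mx.
    by rewrite mulmxDl u0 -scalemxAl v0 scaler0 addr0.
  have kerg j (w : 'rV[P]_t) : w *m D = 0 -> row_component sh j w *m D = 0.
    move=> wD; rewrite -(row_component_mul _ _ Dh) wD.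
    by apply/rowP => l; rewrite !mxE raddf0.
  by exists (Stage kers kerg Dmin), D.
have [t tD] := constructive_indefinite_description _ ex_t.
exists t; exact: constructive_indefinite_description.
Qed.

Lemma min_graded_res_ex (I : P -> Prop) : ideal I ->
  (forall j f, I f -> I (hcomp 0 j f)) -> (forall f, I f -> irrelevant f) ->
  inhabited (min_graded_res I).
Proof.
move=> Is Ih Im.
pose N (v : 'rV[P]_1) := I (v 0 0).
have Ns : submod N.
  split=> [|r u v Nu Nv]; rewrite /N; first by rewrite mxE; case: Is.
  by rewrite mxE [X in _ + X]mxE; apply: Is.2.
have Ng j v : N v -> N (row_component (fun=> 0%N) j v) by rewrite /N mxE; apply: Ih.
have Nm (v : 'rV[P]_1) k : N v -> irrelevant (v 0 k) by rewrite ord1; apply: Im.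
pose st i := iter i (fun s => projT1 (next_stage s)) (Stage Ns Ng Nm).
pose D i : 'M_(stage_rk (st i.+1), stage_rk (st i)) := sval (projT2 (next_stage (st i))).
have DP i : covers (D i) by apply: (svalP (projT2 (next_stage (st i)))).
split; apply: (@MinGradedRes K n I (fun i => stage_rk (st i))
  (fun i => @stage_shift (st i)) D) => //.
- by move=> i; have [] := DP i.
- move=> i k l; have [_ gen _] := DP i.
  have Nk : stage_mod (row k (D i)).
    by apply/gen; exists (delta_mx 0 k); rewrite rowE.
  by have := stage_min l Nk; rewrite mxE.
- move=> v; have [_ gen _] := DP 0%N; rewrite -gen.
  by split=> [/(_ ord0) //|Nv k]; rewrite ord1.
- by move=> i v; have [_ _ <-] := DP i; have [_ gen _] := DP i.+1.
Qed.
End Resolution.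

(** * Betti numbers and Koszul homology *)

Section Rows.
Variables (K : fieldType) (n : nat).
Local Notation P := {mpoly K[n]}.
Local Notation X := (fun j : 'I_n => 'X_j : P).

Lemma kos_coord r (c : {set 'I_n} -> 'rV[P]_r) G k :
  kos X c G 0 k = kos X (fun H => c H 0 k : P^o) G.
Proof. by rewrite /kos summxE; apply: eq_bigr => j _; rewrite mxE. Qed.

Lemma kos_mulmx r' r (D : 'M[P]_(r', r)) (c : {set 'I_n} -> 'rV[P]_r') G :
  kos X (fun H => c H *m D) G = kos X c G *m D.
Proof.
by rewrite /kos mulmx_suml; apply: eq_bigr => j _; rewrite -scalemxAl.
Qed.

Lemma koszul_exact_row r p (c : {set 'I_n} -> 'rV[P]_r) :
  kdeg p.+1 c -> (forall G, kos X c G = 0) ->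
  exists2 b, kdeg p.+2 b & forall G, c G = kos X b G.
Proof.
move=> cp c0.
have coord k : exists b : {set 'I_n} -> P^o, kdeg p.+2 b /\ forall G, c G 0 k = kos X b G.
  have [|G|b bp bE] := @koszul_exact K n p (fun G => c G 0 k).
  - by move=> G Gp; rewrite cp // mxE.
  - by rewrite -kos_coord c0 mxE.
  - by exists b.
have [b bP] := choice _ coord.
exists (fun G => \row_k b k G) => [G Gp | G].
  by apply/rowP => k; rewrite !mxE; apply: (bP k).1.
apply/rowP => k; rewrite (bP k).2 kos_coord; apply: eq_bigr => j _.
by rewrite mxE.
Qed.

Lemma irrelevant_boundary r (u : 'rV[P]_r) : (forall k, irrelevant (u 0 k)) ->
  exists2 b, kdeg 1 b & forall G, (if G == set0 then u else 0) = kos X b G.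
Proof.
move=> um; have [t tE] := choice _ (fun k => (irrelevant_comb (u 0 k)).1 (um k)).
pose b (G : {set 'I_n}) : 'rV[P]_r :=
  \sum_j if G == [set j] then \row_k t k j else 0.
have b1 : kdeg 1 b.
  move=> G G1; rewrite /b big1 // => j _; case: eqP => // GE.
  by rewrite GE cards1 in G1.
exists b => // G; case: eqP => [-> | /eqP G0]; last first.
  by rewrite (kdeg_kos X b1) // cards_eq0.
apply/rowP => k; rewrite tE kos_coord /kos [RHS](eq_bigl xpredT); last first.
  by move=> j; rewrite inE.
apply: eq_bigr => j _; rewrite setU0 /b (bigD1 j) //= eqxx big1 ?addr0.
  by rewrite mxE /ksign big_set0 mul1r regularZ mulrC.
by move=> l lj; case: eqP => // /set1_inj jl; rewrite jl eqxx in lj.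
Qed.

Lemma irrelevant_kos r (b : {set 'I_n} -> 'rV[P]_r) G k : irrelevant (kos X b G 0 k).
Proof.
rewrite /kos summxE; apply: (submod_sum (submod_ideal_gen _)) => j _.
rewrite mxE mulrAC; apply: (submodZ (V := P^o) (submod_ideal_gen _)).
by apply: ideal_gen_mem; exists j.
Qed.

Lemma irrelevant_mulmx r' r (D : 'M[P]_(r', r)) (w : 'rV[P]_r') l :
  (forall k, irrelevant (D k l)) -> irrelevant ((w *m D) 0 l).
Proof.
move=> Dm; rewrite mxE; apply: (submod_sum (submod_ideal_gen _)) => k _.
by apply: (submodZ (V := P^o) (submod_ideal_gen _)); apply: Dm.
Qed.

Definition chain_component r (sh : 'I_r -> nat) j (c : {set 'I_n} -> 'rV[P]_r) (G : {set 'I_n}) :=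
  row_component (fun k => #|G| + sh k)%N j (c G).

Lemma kos_chain_component r (sh : 'I_r -> nat) j (c : {set 'I_n} -> 'rV[P]_r) G :
  kos X (chain_component sh j c) G = chain_component sh j (kos X c) G.
Proof.
apply/rowP => k; rewrite kos_coord [RHS]mxE kos_coord /kos raddf_sum /=.
apply: eq_bigr => l lG; rewrite mxE !regularZ.
have homX : (ksign P l G * 'X_l) \is 1.-homog.
  by rewrite ksignC mul_mpolyC; apply/rpredZ; rewrite dhomogX /= mdeg1.
rewrite [in RHS]mulrC (hcomp_mul _ _ _ homX) mulrC.
by rewrite cardsU1 lG -addnA addnC addnAC.
Qed.

Lemma kdeg_chain_component r (sh : 'I_r -> nat) j p (c : {set 'I_n} -> 'rV[P]_r) :
  kdeg p c -> kdeg p (chain_component sh j c).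
Proof.
by move=> cp G Gp; apply/rowP => k; rewrite !mxE cp // mxE raddf0.
Qed.

Lemma chain_component_mulmx r' r sh' sh (D : 'M[P]_(r', r)) j c G : homog_mx sh' sh D ->
  chain_component sh j (fun H => c H *m D) G = chain_component sh' j c G *m D.
Proof.
move=> Dh; apply: row_component_mul => k l /Dh[e -> De].
by exists e; rewrite // addnA.
Qed.

Lemma row_choice r' r p (D : 'M[P]_(r', r)) (c : {set 'I_n} -> 'rV[P]_r) : kdeg p c ->
  (forall G, exists w, c G = w *m D) ->
  exists2 e, kdeg p e & forall G, c G = e G *m D.
Proof.
move=> cp /choice[e eE]; exists (fun G : {set 'I_n} => if #|G| == p then e G else 0).
  by move=> G /negPf->.
by move=> G; case: ifPn => [_|/cp ->]; [apply: eE | rewrite mul0mx].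
Qed.
End Rows.

Section Betti.
Variables (K : fieldType) (n : nat).
Local Notation P := {mpoly K[n]}.
Local Notation X := (fun j : 'I_n => 'X_j : P).
Variables (I : P -> Prop) (F : min_graded_res I).
Implicit Types (i j p : nat) (G : {set 'I_n}).

Local Notation D := (diff F).
Local Notation sh i := (@shift _ _ _ F i).

Definition im_diff i (v : 'rV[P]_(rk F i)) : Prop := exists w, v = w *m D i.

(** The part of degree j of H_p vanishes for the cokernel of D i, which is R/I
    for i = 0 and the image of D i.-1 otherwise. *)
Definition syz_vanish p i j : Prop := forall c, kdeg p c ->
  (forall G, im_diff (kos X c G)) ->
  exists2 b, kdeg p.+1 b & forall G, im_diff (chain_component (sh i) j c G - kos X b G).

Lemma diff_homog_mx i : homog_mx (sh i.+1) (sh i) (D i).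
Proof. exact: diff_homog. Qed.

(** The cokernel of D i is the quotient of F_i by the cokernel of D i.+1, and
    F_i is acyclic in positive degrees, so that H_(p+1) of the former is H_p
    of the latter. For p = 0 this uses minimality: D i maps F_(i+1) into mF_i,
    that is, into boundaries. *)
Lemma syz_vanish_shift p i j : syz_vanish p.+1 i j <-> syz_vanish p i.+1 j.
Proof.
split=> van.
  move=> e ep eim.
  have eD0 G : kos X (fun H => e H *m D i) G = 0.
    by rewrite kos_mulmx; apply/diff_exact; apply: eim.
  have [c cp cE] : exists2 c, kdeg p.+1 c & forall G, e G *m D i = kos X c G.
    case: p ep {van eim} => [|p] ep.
      have [k|c c1 cE] := @irrelevant_boundary K n _ (e set0 *m D i).
        by apply: irrelevant_mulmx => l; apply: diff_min.
      exists c => // G; rewrite -cE; case: eqP => [->//|/eqP G0].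
      by rewrite ep ?mul0mx // cards_eq0.
    apply: koszul_exact_row => // G Gp; rewrite ep ?mul0mx //.
  have [|b bp bim] := van c cp; first by move=> G; exists (e G).
  have [|e' e'p e'E] :=
    @row_choice _ _ _ _ p.+1 (D i) (fun G => chain_component (sh i) j c G - kos X b G) _ bim.
    by move=> G Gp; rewrite (kdeg_chain_component _ _ cp) // (kdeg_kos X bp) // subr0.
  exists e' => // G; apply/diff_exact; rewrite mulmxBl.
  rewrite -(chain_component_mulmx _ _ _ (@diff_homog_mx i)) -kos_mulmx.
  have -> : chain_component (sh i) j (fun H => e H *m D i) G = kos X (chain_component (sh i) j c) G.
    by rewrite kos_chain_component /chain_component cE.
  have gE H : chain_component (sh i) j c H = e' H *m D i + 1 *: kos X b H.
    by rewrite scale1r -e'E subrK.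
  by rewrite (kos_comb X gE) kos_kos scaler0 addr0 subrr.
move=> c cp cim.
have [e ep eE] := row_choice (kdeg_kos X cp) cim.
have [|b bp bim] := van e ep.
  move=> G; apply/diff_exact; rewrite -kos_mulmx.
  by rewrite -(eq_kos X eE) kos_kos.
have dE G : chain_component (sh i) j c G - b G *m D i =
    chain_component (sh i) j c G + (-1) *: (b G *m D i).
  by rewrite scaleN1r.
have [||b' b'p b'E] :=
  @koszul_exact_row K n _ p (fun G => chain_component (sh i) j c G - b G *m D i).
- move=> G Gp; rewrite (kdeg_chain_component _ _ cp) // bp // mul0mx subr0 //.
- move=> G; rewrite (kos_comb X dE) kos_chain_component kos_mulmx scaleN1r.
  rewrite {1}/chain_component eE -/(chain_component (sh i) j (fun H => e H *m D i) G).
  rewrite (chain_component_mulmx _ _ _ (@diff_homog_mx i)) -mulmxBl.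
  by apply/diff_exact; apply: bim.
exists b' => // G; exists (b G); rewrite -b'E.
by rewrite opprB addrCA subrr addr0.
Qed.

Lemma im_diff_irrelevant i v k : @im_diff i v -> irrelevant (v 0 k).
Proof. by move=> [w ->]; apply: irrelevant_mulmx => l; apply: diff_min. Qed.

(** H_0 of the cokernel of D i is F_i/mF_i, since D i has entries in m. *)
Lemma syz_vanish0 i j : syz_vanish 0 i j <-> forall k, sh i k != j.
Proof.
split=> [van k | noj c c0 _]; last first.
  have [k|b b1 bE] := @irrelevant_boundary K n _ (chain_component (sh i) j c set0).
    apply/irrelevantE; rewrite !mxE mcoeff_hcomp mdeg0 addn0 cards0.
    by rewrite (negPf (noj k)).
  exists b => // G; exists 0; rewrite mul0mx -bE; case: eqP => [->|/eqP G0].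
    by rewrite subrr.
  by rewrite (kdeg_chain_component _ _ c0) ?subrr // cards_eq0.
apply/negP => /eqP kj.
pose c (G : {set 'I_n}) : 'rV[P]_(rk F i) := if G == set0 then delta_mx 0 k else 0.
have c0 : kdeg 0 c by move=> G; rewrite /c cards_eq0 => /negPf->.
have [|b b1 bim] := van c c0.
  by move=> G; exists 0; rewrite mul0mx (kos_kdeg0 X c0).
apply: (@irrelevant_proper K n).
have -> : 1 = (chain_component (sh i) j c set0 - kos X b set0) 0 k + kos X b set0 0 k :> P.
  rewrite !mxE subrK /c eqxx mxE !eqxx cards0 kj /hcomp leqnn subnn.
  by rewrite pihomog_dE //; apply: dhomog1; rewrite mdeg0.
apply: (submodD (V := P^o) (submod_ideal_gen _)).
  exact/im_diff_irrelevant/bim.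
exact: irrelevant_kos.
Qed.

Lemma syz_vanish_betti p i j : syz_vanish p i j <-> syz_vanish 0 (p + i) j.
Proof.
by elim: p i => [|p IH] i //; rewrite syz_vanish_shift IH addnS.
Qed.

Lemma syz_vanish_graded p j : syz_vanish p 0 j <-> graded_vanish p j I.
Proof.
have [k0 k0P] : exists k0 : 'I_(rk F 0), forall k, k = k0.
  have : (0 < rk F 0)%N by rewrite rk0.
  move=> r0; exists (Ordinal r0) => k; apply: val_inj => /=.
  by have := ltn_ord k; rewrite [in X in (_ < X)%N]rk0; case: (val k).
have imE v : @im_diff 0 v <-> I (v 0 k0).
  rewrite /im_diff -augmentation_exact; split=> [/(_ k0)//|Iv k].
  by rewrite (k0P k).
have componentE c G : chain_component (sh 0) j c G 0 k0 = hcomp #|G| j (c G 0 k0).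
  by rewrite mxE shift0 addn0.
split=> van.
  move=> c [cp cI]; pose c' (G : {set 'I_n}) : 'rV[P]_(rk F 0) := const_mx (c G).
  have c'E G : c' G 0 k0 = c G by rewrite mxE.
  have [||b bp bI] := van c'.
  - by move=> G Gp; apply/rowP => k; rewrite !mxE cp.
  - move=> G; apply/imE; rewrite kos_coord (_ : kos _ _ G = kos X c G) //.
    by apply: eq_bigr => l _; rewrite c'E.
  exists (fun G => b G 0 k0) => [G Gp | G]; first by rewrite bp // mxE.
  by have /imE := bI G; rewrite mxE [X in _ + X]mxE componentE c'E kos_coord.
move=> c cp cim.
have [|b bp bI] := van (fun G => c G 0 k0).
  split=> [G Gp | G]; first by rewrite cp // mxE.
  by rewrite -kos_coord; apply/imE.
pose b' (G : {set 'I_n}) : 'rV[P]_(rk F 0) := const_mx (b G).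
exists b' => [G Gp | G]; first by apply/rowP => k; rewrite !mxE bp.
apply/imE; rewrite mxE [X in _ + X]mxE componentE kos_coord.
rewrite (_ : kos X (fun H => b' H 0 k0 : P^o) G = kos X b G); first exact: bI.
by apply: eq_bigr => l _; rewrite mxE.
Qed.

(** By dimension shifting, the part of degree j of H_i(R/I) is that of
    F_i/mF_i. *)
Lemma betti_eq0 i j : betti F i j = 0%N <-> graded_vanish i j I.
Proof.
rewrite -syz_vanish_graded syz_vanish_betti addn0 syz_vanish0 /betti.
split=> [/eqP | noj]; last first.
  by apply/eqP; rewrite cards_eq0; apply/eqP/setP => k; rewrite !inE (negPf (noj k)).
by rewrite cards_eq0 => /eqP/setP b0 k; have := b0 k; rewrite !inE => ->.
Qed.
End Betti.

(** * Relabelling exponents *)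

Section SortedList.
Variables (s : seq nat) (srt : sorted ltn s).

Lemma uniq_ltn_sorted : uniq s.
Proof. by apply: sorted_uniq srt; [apply: ltn_trans | apply: ltnn]. Qed.

Lemma ltn_nth_index x i : x \in s -> (i < size s)%N ->
  (x < nth 0%N s i)%N = (index x s < i)%N.
Proof.
move=> xs ls; have ix : (index x s < size s)%N by rewrite index_mem.
have mono k l : (l < size s)%N -> (k < l)%N -> (nth 0%N s k < nth 0%N s l)%N.
  move=> ll kl; apply: (sorted_ltn_nth ltn_trans) => //.
  exact: ltn_trans ll.
rewrite -{1}(nth_index 0%N xs).
case: (ltngtP (index x s) i) => [li | li | ->]; last exact: ltnn.
  exact: mono.
by apply/negbTE; rewrite -leqNgt ltnW // mono.
Qed.

Lemma leq_nth_index x i : x \in s -> (i < size s)%N ->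
  (x <= nth 0%N s i)%N = (index x s <= i)%N.
Proof.
move=> xs ls; rewrite leq_eqVlt ltn_nth_index // [RHS]leq_eqVlt; congr (_ || _).
apply/eqP/eqP => [->|<-]; first by rewrite index_uniq ?uniq_ltn_sorted.
by rewrite nth_index.
Qed.

Lemma leq_nth_sorted i : (i < size s)%N -> (i <= nth 0%N s i)%N.
Proof.
elim: i => // i IH ls; apply: leq_ltn_trans (IH (ltnW ls)) _.
by apply: (sorted_ltn_nth ltn_trans) => //; apply: ltnW.
Qed.

Hypothesis s0 : 0%N \in s.

Lemma index_sorted0 : index 0%N s = 0%N.
Proof.
have s1 : (0 < size s)%N by case: (s) s0.
by apply/eqP; rewrite -leqn0 -(leq_nth_index s0 s1).
Qed.

Lemma nth_sorted_eq0 i : (i < size s)%N -> (nth 0%N s i == 0%N) = (i == 0%N).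
Proof.
move=> ls; have := ltn_nth_index s0 ls; rewrite index_sorted0 !lt0n.
by move=> /(congr1 negb); rewrite !negbK.
Qed.

Lemma index_sorted_eq0 x : x \in s -> (index x s == 0%N) = (x == 0%N).
Proof.
by move=> xs; rewrite -nth_sorted_eq0 ?index_mem // nth_index.
Qed.
End SortedList.

Section Relabel.
Variables (n q : nat) (A : 'M[nat]_(n, q)) (L : 'I_n -> seq nat).
Hypotheses (Lsrt : forall i, sorted ltn (L i)) (L0 : forall i, 0%N \in L i).
Hypothesis AL : forall i k, A i k \in L i.

(** The exponents of the monomials in the ideal generated by the columns of
    B. *)
Definition above (B : 'M[nat]_(n, q)) (m : 'X_{1..n}) : Prop :=
  exists k, forall i, (B i k <= m i)%N.

Definition relabel : 'M[nat]_(n, q) := \matrix_(i, k) index (A i k) (L i).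

Definition unlabel (b : 'X_{1..n}) : 'X_{1..n} := [multinom nth 0%N (L i) (b i) | i < n].

Definition in_box (b : 'X_{1..n}) : bool := [forall i, (b i < size (L i))%N].

Definition box_pairs : seq ('X_{1..n} * 'X_{1..n}) :=
  [seq (unlabel b, b) |
     b <- [seq val b | b <- enum {: 'X_{1..n < (\sum_i size (L i)).+1}}] & in_box b].

Lemma mem_box_pairs p : reflect (exists2 b, in_box b & p = (unlabel b, b)) (p \in box_pairs).
Proof.
apply: (iffP mapP) => [[b + ->] | [b bb ->]]; first by rewrite mem_filter => /andP[bb _]; exists b.
exists b => //; rewrite mem_filter bb /=.
have bs : (mdeg b < (\sum_i size (L i)).+1)%N.
  rewrite ltnS mdegE; apply: leq_sum => i _; apply: ltnW.
  by move/forallP: bb.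
by apply/mapP; exists (BMultinom bs); rewrite ?mem_enum.
Qed.

Lemma unlabel_inj b b' : in_box b -> in_box b' -> unlabel b = unlabel b' -> b = b'.
Proof.
move=> /forallP bb /forallP bb' /mnmP E; apply/mnmP => i.
have := E i; rewrite !mnmE => /(congr1 (fun x => index x (L i))).
by rewrite !index_uniq ?uniq_ltn_sorted.
Qed.

Lemma uniq_box_pairs : uniq box_pairs.
Proof.
rewrite map_inj_uniq => [|b b' []//]; apply: filter_uniq.
by rewrite map_inj_uniq ?enum_uniq //; apply: val_inj.
Qed.

(** Only entries of row i are compared with the coordinate i, and for those
    the sorted list L i turns x <= L_b into index x <= b, and x < L_b into
    index x < b; the strict form is needed for the variables in G. *)
Lemma above_relabel b G : in_box b -> (set_mnm G <= unlabel b)%MM ->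
  above A (unlabel b - set_mnm G)%MM <-> above relabel (b - set_mnm G)%MM.
Proof.
move=> /forallP bb /set_mnm_le Gb.
suff E k i : (A i k <= (unlabel b - set_mnm G)%MM i)%N = (relabel i k <= (b - set_mnm G)%MM i)%N.
  by split=> -[k kP]; exists k => i; rewrite ?E // -E.
rewrite !mnmE mxE; case: (boolP (i \in G)) => iG; last by rewrite !subn0 leq_nth_index.
have := Gb i iG; rewrite mnmE => nz.
have bnz : b i != 0%N by rewrite -(nth_sorted_eq0 (Lsrt i) (L0 i)).
rewrite !subn1 -ltnS prednK ?lt0n // ltn_nth_index //.
by rewrite -[RHS]ltnS prednK // lt0n.
Qed.

(** A vector a that is not matched has a coordinate a_i outside L i; it is
    nonzero as 0 is in L i, and no generator has exponent a_i there, so that a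
    is a cone over x_i. *)
Lemma matched_relabel : matched (above A) (above relabel) box_pairs.
Proof.
split; first exact: uniq_box_pairs.
- move=> _ _ /mem_box_pairs[b _ ->] /mem_box_pairs[b' _ ->] /= ->; exact: erefl.
- move=> _ /mem_box_pairs[b /forallP bb ->] i /=.
  by rewrite mnmE nth_sorted_eq0.
- by move=> _ /mem_box_pairs[b bb ->] G; apply: above_relabel.
move=> a aps.
have [i ai] : exists i, a i \notin L i.
  apply: NNPP => no; case/negP: aps; apply/mapP.
  have aL i : a i \in L i by apply: contraT => ai; case: no; exists i.
  exists (a, [multinom index (a i) (L i) | i < n]) => //.
  apply/mem_box_pairs; exists [multinom index (a i) (L i) | i < n].
    by apply/forallP => i; rewrite mnmE index_mem.
  by congr (_, _); apply/mnmP => i; rewrite !mnmE nth_index.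
exists i; first by apply: contraNneq ai => ->.
move=> G iG _ [k kP]; exists k => l; have := kP l.
rewrite !mnmE !inE; case: eqVneq => [->|//].
rewrite (negPf iG) subn0 leq_eqVlt => /orP[/eqP E | ]; last by rewrite subn1; lia.
by rewrite -E AL in ai.
Qed.

(** A vector of labels out of the box has a coordinate b_i larger than all
    labels of row i, hence is a cone over x_i. *)
Lemma matched_relabel_swap : matched (above relabel) (above A) (swap_pairs box_pairs).
Proof.
split.
- rewrite map_inj_uniq ?uniq_box_pairs // => -[? ?] [? ?] /= [-> ->] //.
- move=> _ _ /mapP[_ /mem_box_pairs[b bb ->] ->] /mapP[_ /mem_box_pairs[b' bb' ->] ->] /=.
  by move/(unlabel_inj bb bb') => ->.
- move=> _ /mapP[_ /mem_box_pairs[b /forallP bb ->] ->] i /=.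
  by rewrite mnmE nth_sorted_eq0.
- move=> _ /mapP[_ /mem_box_pairs[b bb ->] ->] G /= /set_mnm_le Gb.
  apply: iff_sym; apply: above_relabel => //; apply/set_mnm_le => i /Gb.
  by rewrite mnmE nth_sorted_eq0 //; move/forallP: bb.
move=> b bps.
have /forallPn[i bi] : ~~ in_box b.
  apply: contra bps => bb; apply/mapP; exists (b, unlabel b) => //.
  apply/mapP; exists (unlabel b, b) => //.
  by apply/mem_box_pairs; exists b.
rewrite -leqNgt in bi.
have Li : (0 < size (L i))%N by case: (L i) (L0 i).
exists i; first by rewrite -lt0n (leq_trans Li).
move=> G iG _ [k kP]; exists k => l; have := kP l.
rewrite !mnmE !inE; case: eqVneq => [->|//]; rewrite mxE => _ /=.
have := AL i k; rewrite -index_mem => /leq_trans/(_ bi).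
by case: (b i) => // d; rewrite subn1.
Qed.

Lemma mdeg_box_pairs p : p \in box_pairs -> (mdeg p.2 <= mdeg p.1)%N.
Proof.
move=> /mem_box_pairs[b /forallP bb ->]; rewrite !mdegE; apply: leq_sum => i _ /=.
by rewrite mnmE leq_nth_sorted.
Qed.
End Relabel.

(** * Incidence matrices, signatures and height *)

Section MonomialIdeals.
Variables (K : fieldType) (n : nat).
Local Notation P := {mpoly K[n]}.
Implicit Types (I : P -> Prop).

Lemma ideal_gen_monomials (S : 'X_{1..n} -> Prop) :
  monomial_pred (ideal_gen (fun g : P => exists2 m, S m & g = 'X_[m]))
    (fun m => exists2 s, S s & (s <= m)%MM).
Proof.
move=> f; split=> [|fS].
  pose J (f : P) := forall m, m \in msupp f -> exists2 s, S s & (s <= m)%MM.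
  apply: (@ideal_gen_min _ _ J) => [|g [s Ss ->] m]; last first.
    by rewrite msuppX inE => /eqP->; exists s => //; apply: lepm_refl.
  split=> [m|r u v Ju Jv m]; first by rewrite msupp0.
  move/msuppD_le; rewrite mem_cat regularZ => /orP[/Ju//|/msuppM_le/allpairsP].
  move=> [[m1 m2] /= [_ /Jv[s Ss sm] ->]]; exists s => //.
  exact: lepm_trans sm (lem_addl _ _).
rewrite (mpolyE f) big_seq; apply: (submod_sum (submod_ideal_gen _)) => m /fS[s Ss sm].
rewrite -(submK sm) mpolyXD scalerAl.
apply: (submodZ (V := P^o) (submod_ideal_gen _)).
by apply: ideal_gen_mem; exists s.
Qed.

Lemma col_idealP q (A : 'M[nat]_(n, q)) (T : {set 'I_q}) :
  monomial_pred (col_ideal A T : P -> Prop)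
    (fun m => exists2 k, k \in T & forall i, (A i k <= m i)%N).
Proof.
move=> f.
have -> : col_ideal A T f <->
    ideal_gen (fun g : P => exists2 m, (exists2 k, k \in T & m = col_mnm A k) & g = 'X_[m]) f.
  by split; apply: ideal_gen_sub => g; [move=> [k kT ->] | move=> [_ [k kT ->] ->]];
     [exists (col_mnm A k) => //; exists k | exists k].
rewrite ideal_gen_monomials; split=> fU m /fU.
  move=> [_ [k kT ->] /mnm_lepP km]; exists k => // i.
  by have := km i; rewrite mnmE.
move=> [k kT km]; exists (col_mnm A k); first by exists k.
by apply/mnm_lepP => i; rewrite mnmE.
Qed.

Lemma col_ideal_setT q (A : 'M[nat]_(n, q)) :
  monomial_pred (col_ideal A setT : P -> Prop) (above A).
Proof.
move=> f; rewrite (col_idealP A setT f).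
by split=> fU m /fU [k]; [move=> _ kP; exists k | move=> kP; exists k].
Qed.

Lemma ideal_col_ideal q (A : 'M[nat]_(n, q)) T : ideal (col_ideal A T : P -> Prop).
Proof. exact: submod_ideal_gen. Qed.

Lemma monomial_predX I U m : monomial_pred I U -> I 'X_[m] <-> U m.
Proof.
move=> IU; rewrite (IU 'X_[m]); split=> [|Um m']; first by apply; rewrite msuppX mem_head.
by rewrite msuppX inE => /eqP->.
Qed.

Lemma incidence_matrix_ex I : monomial_ideal I ->
  exists q (A : 'M[nat]_(n, q)), incidence_matrix I A.
Proof.
move=> [S IS].
pose Q q := exists A : 'M[nat]_(n, q), forall f, I f <-> col_ideal A setT f.
(* A generating set with the least number of columns has no superfluous
   column. *)
have [q [A IA] qmin] : exists2 q, Q q & forall q', (q' < q)%N -> ~ Q q'.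
  apply: ex_min_nat; have [L LS Lm] := dickson S.
  exists (size L), (\matrix_(i, k) (nth 0%MM L k) i) => f.
  rewrite (col_ideal_setT _ f) IS (ideal_gen_monomials S f); split=> fU m /fU.
    move=> [s /Lm[l lL ls] sm].
    have lk : (index l L < size L)%N by rewrite index_mem.
    exists (Ordinal lk) => i; rewrite mxE /= nth_index //.
    exact: (mnm_lepP (lepm_trans ls sm)).
  move=> [k km]; exists (nth 0%MM L k); first by apply: LS; apply: mem_nth.
  by apply/mnm_lepP => i; have := km i; rewrite mxE.
exists q, A; split=> // T IT; apply/eqP; apply: contraT => TT.
have Tq : (#|T| < q)%N.
  rewrite -[X in (_ < X)%N]card_ord -cardsT; apply: proper_card.
  by rewrite properEneq TT subsetT.
case: (qmin _ Tq); exists (\matrix_(i, k) A i (enum_val k)) => f.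
rewrite IT (col_ideal_setT _ f) (col_idealP A T f).
split=> fU m /fU; last first.
  move=> [k km]; exists (enum_val k); first exact: enum_valP.
  by move=> i; have := km i; rewrite mxE.
move=> [k kT km]; exists (enum_rank_in kT k) => i.
by rewrite mxE enum_rankK_in.
Qed.

Section Incidence.
Variables (I : P -> Prop) (q : nat) (A : 'M[nat]_(n, q)) (IA : incidence_matrix I A).

Lemma incidence_pred : monomial_pred I (above A).
Proof. by move=> f; rewrite IA.1; apply: col_ideal_setT. Qed.

Lemma incidence_min k k' : (forall i, (A i k' <= A i k)%N) -> k' = k.
Proof.
move=> k'k; apply/eqP; apply: contraT => nk.
suff /(IA.2 (setT :\ k))/setP/(_ k) : forall f, I f <-> col_ideal A (setT :\ k) f.
  by rewrite !inE eqxx.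
move=> f; rewrite (incidence_pred f) (col_idealP A _ f); split=> fU m /fU.
  move=> [l lm]; have [lk | lk] := eqVneq l k; last by exists l; rewrite // !inE lk.
  exists k'; first by rewrite !inE nk.
  by move=> i; rewrite (leq_trans (k'k i)) // -lk.
by move=> [l _ lm]; exists l.
Qed.
End Incidence.

(** Each column of A is divisible by a column of B, which is divisible by a
    column of A; minimality forces equality. *)
Lemma incidence_col I q q' (A : 'M[nat]_(n, q)) (B : 'M[nat]_(n, q')) k :
  incidence_matrix I A -> incidence_matrix I B ->
  exists k', forall i, A i k = B i k'.
Proof.
move=> IA IB.
have colI (q0 : nat) (C : 'M[nat]_(n, q0)) l : incidence_matrix I C -> I 'X_[col_mnm C l].
  move=> IC; apply/(monomial_predX _ (incidence_pred IC)); exists l => i.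
  by rewrite mnmE.
have /(monomial_predX _ (incidence_pred IB))[k' k'k] := colI _ _ k IA.
have /(monomial_predX _ (incidence_pred IA))[k2 k2k'] := colI _ _ k' IB.
exists k' => i; apply/eqP; rewrite eqn_leq.
have kk2 : k2 = k.
  apply: (incidence_min IA) => l; have := k'k l; have := k2k' l; rewrite !mnmE.
  exact: leq_trans.
by have := k'k i; have := k2k' i; rewrite !mnmE kk2 => -> ->.
Qed.

Definition row_values q (A : 'M[nat]_(n, q)) i : seq nat :=
  sort leq (undup [seq A i k | k : 'I_q]).

Lemma mem_row_values q (A : 'M[nat]_(n, q)) i v :
  reflect (exists k, v = A i k) (v \in row_values A i).
Proof.
rewrite mem_sort mem_undup; apply: (iffP mapP) => [[k _ ->]|[k ->]]; first by exists k.
by exists k; rewrite ?mem_enum.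
Qed.

Lemma row_values_sorted q (A : 'M[nat]_(n, q)) i : sorted ltn (row_values A i).
Proof.
rewrite ltn_sorted_uniq_leq sort_uniq undup_uniq /=.
exact/sort_sorted/leq_total.
Qed.

Lemma sgn_mx_relabel q (A : 'M[nat]_(n, q)) : sgn_mx A = relabel A (row_values A).
Proof. by []. Qed.

(** Two incidence matrices have the same columns, hence the same entries in
    each row and the same labels. *)
Lemma sgn_ideal_incidence I q (A : 'M[nat]_(n, q)) : incidence_matrix I A ->
  forall f, sgn_ideal I f <-> col_ideal (sgn_mx A) setT f.
Proof.
move=> IA f; split=> [[q' [B [IB]]] | sf]; last by exists q, A.
rewrite (col_ideal_setT _ f) (col_ideal_setT _ f) => fU m /fU[k km].
have [k' kk'] := incidence_col k IB IA.
exists k' => i; have := km i; rewrite !sgn_mx_relabel !mxE kk'.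
suff -> : row_values B i = row_values A i by [].
apply/perm_sortP; [exact: leq_total | exact: leq_trans | exact: anti_leq |].
apply: uniq_perm; rewrite ?undup_uniq // => v.
rewrite !mem_undup; apply/mapP/mapP => -[l _ ->].
  by have [l' ll'] := incidence_col l IB IA; exists l'; rewrite ?mem_enum.
by have [l' ll'] := incidence_col l IA IB; exists l'; rewrite ?mem_enum.
Qed.

Section Height.
Variable i : 'I_n.

(** Substitution of 0 for x_i, with kernel the prime ideal generated by
    x_i. *)
Definition kill_var : {mpoly K[n]} -> {mpoly K[n]} :=
  comp_mpoly [tuple (if k == i then 0 else 'X_k : P) | k < n].

Lemma kill_varX m : kill_var 'X_[m] = if m i == 0%N then 'X_[m] else 0.
Proof.
rewrite /kill_var comp_mpolyX; case: eqP => [mi | /eqP mi].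
  rewrite [RHS]mpolyXE_id; apply: eq_bigr => k _; rewrite tnth_mktuple.
  by case: eqP => // ->; rewrite mi !expr0.
by rewrite (bigD1 i) //= tnth_mktuple eqxx expr0n (negPf mi) mul0r.
Qed.

Lemma mcoeff_kill_var f m : (kill_var f)@_m = if m i == 0%N then f@_m else 0.
Proof.
rewrite {1}/kill_var comp_mpolyEX raddf_sum /=.
rewrite (eq_bigr (fun k => f@_k * (if k i == 0%N then (k == m)%:R else 0))); last first.
  move=> k _; rewrite mcoeffZ -/(kill_var _) kill_varX.
  by case: ifP => _; rewrite ?mcoeffX ?mcoeff0.
have [mf | mf] := boolP (m \in msupp f); last first.
  have f0 : f@_m = 0 by apply/eqP; rewrite mcoeff_eq0.
  rewrite f0 if_same big_seq big1 // => k kf; case: ifP => _; rewrite ?mulr0 //.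
  by case: eqP => [km|_]; rewrite ?mulr0 //; rewrite km (negPf mf) in kf.
rewrite (bigD1_seq m) //= eqxx big1 ?addr0 => [|k km].
  by case: ifP => _; rewrite ?mulr1 ?mulr0.
by rewrite (negPf km) if_same mulr0.
Qed.

Definition var_prime : {pred P} := [pred f | kill_var f == 0].

Lemma var_primeP f : reflect (forall m, m \in msupp f -> m i != 0%N) (f \in var_prime).
Proof.
rewrite inE; apply: (iffP eqP) => [f0 m | fi].
  rewrite mcoeff_msupp; apply: contraNneq => mi.
  by have := mcoeff_kill_var f m; rewrite f0 mi eqxx mcoeff0 => <-.
apply/mpolyP => m; rewrite mcoeff_kill_var mcoeff0; case: eqP => // mi.
by apply/eqP; rewrite mcoeff_eq0; apply/negP => /fi; rewrite mi.
Qed.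

Lemma prime_var_prime : prime_ideal var_prime.
Proof.
split; first split.
- by rewrite inE /kill_var comp_mpoly0.
- by rewrite inE /kill_var rmorph1 oner_eq0.
- move=> a u v; rewrite !inE /kill_var => /eqP u0 /eqP v0.
  by rewrite comp_mpolyD rmorphM /= u0 v0 mulr0 addr0.
- by move=> u v; rewrite !inE /kill_var rmorphM mulf_eq0.
Qed.

Lemma var_prime_factor f : f \in var_prime -> exists g, f = 'X_i * g.
Proof.
move/var_primeP => fi; exists (\sum_(m <- msupp f) f@_m *: 'X_[m - U_(i)]).
rewrite {1}(mpolyE f) mulr_sumr big_seq [RHS]big_seq; apply: eq_bigr => m /fi mi.
by rewrite -scalerAr -mpolyXD addmC submK // lep1mP.
Qed.

(** The ideal generated by x_i has height one: a prime strictly inside does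
    not contain x_i, so with f = x_i g it contains g, whose degree is smaller
    than that of f; hence it is 0. *)
Lemma height_var I : height_ge I 2 -> ~ (forall f, I f -> f \in var_prime).
Proof.
move=> ht Ii; have [C [Cp Cs] C2] := ht _ prime_var_prime Ii.
have [sub12 nsub21] := Cs 1%N isT; have [sub01 nsub10] := Cs 0%N isT.
have [[C10 _ C1M] C1p] := Cp 1%N isT; have [[C00 _ _] _] := Cp 0%N isT.
have Xi : 'X_i \notin C 1%N.
  apply/negP => Xi; apply: nsub21 => f; rewrite C2 => /var_prime_factor[g ->].
  by have := C1M g _ _ Xi C10; rewrite addr0 mulrC.
suff C1z f : f \in C 1%N -> f = 0 by apply: nsub10 => f /C1z ->.
have [d] := ubnP (msize f); elim: d f => // d IH f fd fC.
have [g fE] : exists g, f = 'X_i * g by apply: var_prime_factor; rewrite -C2; apply: sub12.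
rewrite fE in fC fd *; have [/eqP-> | g0] := boolP (g == 0); first by rewrite mulr0.
rewrite (IH g) ?mulr0 //.
  move: fd; rewrite msizeM // ?msizeX ?mdeg1 //.
  by rewrite -msize_poly_eq0 msizeX.
by have := C1p _ _ fC; rewrite (negPf Xi).
Qed.
End Height.
End MonomialIdeals.

(** * Comparison of the invariants *)

Lemma predicate_ext (T : Type) (Q Q' : T -> Prop) : (forall t, Q t <-> Q' t) -> Q = Q'.
Proof.
by move=> QQ; apply: functional_extensionality => t; apply: propositional_extensionality.
Qed.

Lemma maximum_is_max d (T : porderType d) (x0 : T) (Q : T -> Prop) :
  (exists x, is_max Q x) -> is_max Q (maximum x0 Q).
Proof. by move=> ex; apply: epsilon_spec. Qed.

Lemma int_max_ex (S : int -> Prop) (B : int) : (exists r, S r) ->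
  (forall r, S r -> r <= B) -> exists r, is_max S r.
Proof.
move=> [r Sr] SB.
have [|k Sk kmin] := @ex_min_nat (fun k => S (B - k%:Z)).
  exists `|B - r|%N; rewrite gez0_abs ?subr_ge0 ?SB //.
  by rewrite opprB addrCA subrr addr0.
exists (B - k%:Z); split=> // y Sy.
rewrite leNgt; apply/negP => ylt; have yB := SB y Sy.
apply: (kmin `|B - y|%N); last first.
  by rewrite gez0_abs ?subr_ge0 // opprB addrCA subrr addr0.
by rewrite -ltz_nat gez0_abs ?subr_ge0 // ltrBlDr -ltrBlDl.
Qed.

Section Regularity.
Variables (K : fieldType) (n : nat).
Local Notation P := {mpoly K[n]}.
Variables (U U' : 'X_{1..n} -> Prop) (I I' : P -> Prop) (ps : seq ('X_{1..n} * 'X_{1..n})).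
Hypotheses (Is : ideal I) (IE : monomial_pred I U).
Hypotheses (I's : ideal I') (I'E : monomial_pred I' U').

Lemma monomial_res_ex : ~ U 0%MM -> inhabited (min_graded_res I).
Proof.
move=> U0; apply: min_graded_res_ex => // [j f /IE fU | f /IE fU].
  apply/IE => m; rewrite mcoeff_msupp mcoeff_hcomp.
  by case: ifP => _; rewrite ?eqxx // -mcoeff_msupp; apply: fU.
apply/irrelevantE/eqP; apply: contraT; rewrite -mcoeff_msupp => f0.
by case: U0; apply: fU.
Qed.

Definition reg_set (r : int) : Prop := exists F : min_graded_res I, exists i j : nat,
  betti F i j != 0%N /\ r = j%:Z - i%:Z.

(** The Betti numbers live in the total degrees of the finitely many matched
    multidegrees, and F_0 contributes the value 0. *)
Lemma reg_set_max : inhabited (min_graded_res I) -> matched U U' ps ->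
  exists r, is_max reg_set r.
Proof.
move=> [F] mps; apply: (@int_max_ex _ (\max_(q <- ps) mdeg q.1)%:Z).
  exists 0, F, 0%N, 0%N; split=> //.
  have r0 : (0 < rk F 0)%N by rewrite rk0.
  rewrite -lt0n; apply/card_gt0P; exists (Ordinal r0).
  by rewrite inE shift0.
move=> _ [F' [i [j [bij ->]]]].
suff : (j <= \max_(q <- ps) mdeg q.1)%N.
  by rewrite -lez_nat; apply: le_trans; rewrite lerBlDr lerDl.
apply: contraR bij => jlt; apply/eqP/betti_eq0.
apply: (graded_vanish_bound Is IE mps) => q qps; apply: contraNneq jlt => <-.
exact: (leq_bigmax_seq (F := fun q : 'X_{1..n} * 'X_{1..n} => mdeg q.1)).
Qed.
End Regularity.

Section Comparison.
Variables (K : fieldType) (n : nat).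
Local Notation P := {mpoly K[n]}.
Variables (U U' : 'X_{1..n} -> Prop) (I I' : P -> Prop) (ps : seq ('X_{1..n} * 'X_{1..n})).
Hypotheses (Is : ideal I) (IE : monomial_pred I U) (U0 : ~ U 0%MM).
Hypotheses (I's : ideal I') (I'E : monomial_pred I' U') (U'0 : ~ U' 0%MM).
Hypotheses (mps : matched U U' ps) (mps' : matched U' U (swap_pairs ps)).

Lemma proper_irrelevant (V : 'X_{1..n} -> Prop) (J : P -> Prop) f :
  monomial_pred J V -> ~ V 0%MM -> J f -> irrelevant f.
Proof.
move=> JE V0 /JE fV; apply/irrelevantE/eqP; apply: contraT.
by rewrite -mcoeff_msupp => /fV.
Qed.

Lemma regular_length_matched k :
  (exists2 s, regular_seq (@irrelevant K n) I s & size s = k) <->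
  (exists2 s, regular_seq (@irrelevant K n) I' s & size s = k).
Proof.
have Im f := @proper_irrelevant U I f IE U0.
have I'm f := @proper_irrelevant U' I' f I'E U'0.
rewrite (depth_geP Is Im) (depth_geP I's I'm).
by split=> van p /van; rewrite (koszul_vanish_matched Is IE I's I'E mps mps').
Qed.

Lemma cm_type1_matched : cm_type I 1 <-> cm_type I' 1.
Proof.
have Im f := @proper_irrelevant U I f IE U0.
have I'm f := @proper_irrelevant U' I' f I'E U'0.
rewrite (cm_type1P Is Im) (cm_type1P I's I'm).
have vanE p := koszul_vanish_matched Is IE I's I'E mps mps' p.
have lineE p := koszul_line_matched Is IE I's I'E mps mps' p.
by split=> -[k [kn van line]]; exists k; split=> // [p /van /vanE // |]; apply/lineE.
Qed.

Lemma regularity_matched : (forall q, q \in ps -> (mdeg q.2 <= mdeg q.1)%N) ->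
  regularity I' <= regularity I.
Proof.
move=> leps.
have resI := monomial_res_ex Is IE U0; have resI' := monomial_res_ex I's I'E U'0.
have [_ maxI] : is_max (reg_set I) (regularity I).
  exact/maximum_is_max/(reg_set_max Is IE resI mps).
have [[F' [i [j [bij ->]]]] _] : is_max (reg_set I') (regularity I').
  exact/maximum_is_max/(reg_set_max I's I'E resI' mps').
have [F] := resI.
have [j' jj' bij'] : exists2 j', (j <= j')%N & betti F i j' != 0%N.
  apply: NNPP => no; move/negP: bij; apply; apply/eqP/betti_eq0.
  apply: (graded_vanish_le Is IE I's I'E mps mps' leps) => j' jj'.
  by apply/(betti_eq0 F)/eqP; apply: contraT => b; case: no; exists j'.
apply: le_trans (maxI (j'%:Z - i%:Z) _); last by exists F, i, j'.
by rewrite lerD2r lez_nat.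
Qed.
End Comparison.

Section Primes.
Variables (K : fieldType) (n : nat).
Local Notation P := {mpoly K[n]}.

Lemma prime_monomial (Q : {pred P}) m : prime_ideal Q ->
  'X_[m] \in Q <-> exists2 i, m i != 0%N & 'X_i \in Q.
Proof.
move=> [[Q0 Q1 QM] Qp]; split=> [|[i mi Xi]]; last first.
  rewrite -(submK (m := U_(i)%MM) (m' := m)) ?lep1mP // mpolyXD.
  by have := QM 'X_[m - U_(i)] _ _ Xi Q0; rewrite addr0.
have [d] := ubnP (mdeg m); elim: d m => // d IH m md mQ.
have [m0 | [i mi]] := mnm0_or m; first by rewrite m0 mpolyX0 (negPf Q1) in mQ.
move: mQ; rewrite -(submK (m := U_(i)%MM) (m' := m)) ?lep1mP // mpolyXD => /Qp/orP[].
  case/IH => [|k km Xk].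
    have := mdegBm (m := U_(i)%MM) (a := m); rewrite lep1mP mdeg1 => /(_ mi) E.
    by rewrite -ltnS -E add1n ltnS in md.
  exists k => //; rewrite submK ?lep1mP //; apply: contraNneq km => mk.
  by rewrite mnmBE mk.
by move=> Xi; exists i; rewrite // submK ?lep1mP.
Qed.

Lemma prime_col_ideal q (A : 'M[nat]_(n, q)) (Q : {pred P}) : prime_ideal Q ->
  (forall f, col_ideal A setT f -> f \in Q) <->
  forall k, exists2 i, A i k != 0%N & 'X_i \in Q.
Proof.
move=> Qp; split=> [AQ k | AQ f].
  have /(prime_monomial _ Qp)[i] : 'X_[col_mnm A k] \in Q.
    by apply: AQ; apply: ideal_gen_mem; exists k.
  by rewrite mnmE => ? ?; exists i.
have [[Q0 Q1 QM] _] := Qp.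
apply: (@ideal_gen_min _ _ (fun f => f \in Q)) => [|g [k _ ->]].
  by split=> // r u v uQ vQ; rewrite addrC; apply: QM.
apply/(prime_monomial _ Qp); have [i Aik Xi] := AQ k.
by exists i; rewrite // mnmE.
Qed.
End Primes.

Theorem theorem2p13 (K : fieldType) (n : nat) (I : {mpoly K[n]} -> Prop)
    (hmon : monomial_ideal I) (hht : height_ge I 2) :
  [/\ quot_depth I = quot_depth (sgn_ideal I),
      quot_dim I = quot_dim (sgn_ideal I),
      (cohen_macaulay I <-> cohen_macaulay (sgn_ideal I)) /\
      (gorenstein I <-> gorenstein (sgn_ideal I))
    & regularity (sgn_ideal I) <= regularity I].
Proof.
have [q [A IA]] := incidence_matrix_ex hmon.
have sgnE : sgn_ideal I = col_ideal (sgn_mx A) setT.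
  exact/predicate_ext/sgn_ideal_incidence.
have IE' : I = col_ideal A setT by apply: predicate_ext; apply: IA.1.
have IE : monomial_pred I (above A) := incidence_pred IA.
have Is : ideal I by rewrite IE'; apply: ideal_col_ideal.
pose I' : {mpoly K[n]} -> Prop := sgn_ideal I.
have I'E : monomial_pred I' (above (sgn_mx A)) by rewrite /I' sgnE; apply: col_ideal_setT.
have I's : ideal I' by rewrite /I' sgnE; apply: ideal_col_ideal.
have srt := row_values_sorted A.
have AL i k : A i k \in row_values A i by apply/mem_row_values; exists k.
have [A0 | A0] := classic (above A 0%MM).
  (* Here I is the whole ring, and so is its signature: a zero entry keeps the
     label 0. *)
  have top (J : {mpoly K[n]} -> Prop) (V : 'X_{1..n} -> Prop) : ideal J -> monomial_pred J V ->
      V 0%MM -> forall f, J f.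
    move=> Js JE V0 f; have J1 : J 1 by rewrite -mpolyX0; apply/(monomial_predX _ JE).
    by rewrite -[f]mulr1; apply: (submodZ (V := {mpoly K[n]}^o) Js).
  have I'0 : above (sgn_mx A) 0%MM.
    have [k k0] := A0; exists k => i.
    have Aik : A i k = 0%N by apply/eqP; rewrite -leqn0 -(mnm0E i) k0.
    have R0 : 0%N \in row_values A i by rewrite -Aik.
    by rewrite mnm0E leqn0 sgn_mx_relabel mxE index_sorted_eq0 ?Aik.
  have -> : sgn_ideal I = I by apply: predicate_ext => f; split=> _;
    [exact: (top _ _ Is IE A0) | exact: (top _ _ I's I'E I'0)].
  by split.
(* A row without the entry 0 would place I in the prime ideal of that
   variable. *)
have row0 i : 0%N \in row_values A i.
  apply/mem_row_values; apply: NNPP => no; apply: (height_var hht (i := i)) => f /IE fA.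
  apply/var_primeP => m /fA[k km]; rewrite -lt0n (leq_trans _ (km i)) // lt0n.
  by apply/eqP => Aik; apply: no; exists k.
have I'0 : ~ above (sgn_mx A) 0%MM.
  move=> [k k0]; apply: A0; exists k => i; have := k0 i.
  by rewrite mnmE !leqn0 sgn_mx_relabel mxE index_sorted_eq0.
have mps := matched_relabel srt row0 AL.
have mps' := matched_relabel_swap srt row0 AL.
rewrite -sgn_mx_relabel in mps mps'.
have depthE : quot_depth I = quot_depth I'.
  congr maximum; apply: predicate_ext.
  exact: (regular_length_matched Is IE A0 I's I'E I'0 mps mps').
have dimE : quot_dim I = quot_dim I'.
  congr maximum; apply: predicate_ext => k.
  have primeE (Q : {pred {mpoly K[n]}}) : prime_ideal Q ->
      (forall f, I f -> f \in Q) <-> (forall f, I' f -> f \in Q).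
    move=> Qp; rewrite /I' sgnE IE' !prime_col_ideal //.
    split=> AQ l; have [i Ail Xi] := AQ l; exists i => //; move: Ail;
      by rewrite sgn_mx_relabel mxE index_sorted_eq0.
  by split=> -[Q Qc IQ]; exists Q => //; apply/primeE => //; apply: Qc.1.
have cmE : cohen_macaulay I <-> cohen_macaulay I' by rewrite /cohen_macaulay depthE dimE.
split=> //; last exact: (regularity_matched Is IE A0 I's I'E I'0 mps mps' (mdeg_box_pairs srt)).
split=> //; rewrite /gorenstein cmE.
by rewrite (cm_type1_matched Is IE A0 I's I'E I'0 mps mps').
Qed.
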